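(* Let $a^2>0$, $c^2>0$, $b^2\ge0$, let $F(t)=-a^2t-\frac{b^2}{3}t^2+\frac{2c^2}{3}t^3$, and let $s_+>0$ be the positive zero of $F$. Let $u$ be the unique solution of $$u''(r)+\frac{2}{r}u'(r)-\frac{6}{r^2}u(r)=F(u(r))\ \text{ in }(0,+\infty),\qquad u(0)=0,\quad \lim_{r\to+\infty}u(r)=s_+ .$$ Denote $w(r):=\frac{ru'(r)}{u(r)}$. Then $$0<w(r)<2\quad\text{for all } r\in(0,+\infty).$$ Moreover, setting $f(u)=\frac{F(u)}{u}$, the following inequalities hold for every $r\in(0,+\infty)$ (with $u=u(r)$, $w=w(r)$): $$u''+\Big(-\frac{3u'}{u}+\frac5r\Big)u'\ge0,$$ $$2a^2+\frac{b^2}{3}u>-\frac{2}{w}f(u),$$ $$\frac{3}{r^2}(w-2)(w+1)<f(u)<\frac{1}{r^2}(w-2)(2w+3)<0.$$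
   Context: A solution is a function $u\in C^2(0,+\infty)$ satisfying the ODE pointwise, with $u(0)=0$ meaning $\lim_{r\to0^+}u(r)=0$. The solution exists, is unique, and is positive on $(0,+\infty)$. Explicitly $s_+=\frac{b^2+\sqrt{b^4+24a^2c^2}}{4c^2}$ and $f(u)=-a^2-\frac{b^2}{3}u+\frac{2c^2}{3}u^2$. *)

(* Defs.v *)
From Stdlib Require Import Reals.
From Coquelicot Require Import Coquelicot.

Open Scope R_scope.

Definition bulkF (a b c t : R) : R :=
  - a ^ 2 * t - b ^ 2 / 3 * t ^ 2 + 2 * c ^ 2 / 3 * t ^ 3.

Definition bulkf (a b c t : R) : R := bulkF a b c t / t.

Definition C2_on_pos (u : R -> R) : Prop :=
  forall r : R, 0 < r ->
    ex_derive u r /\ ex_derive_n u 2 r /\ continuous (Derive_n u 2) r.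

(* Positivity of [u] is not part of the definition.  The values of [u] on
   (-oo, 0] play no role: [u(0) = 0] is the one-sided limit at 0. *)
Definition is_solution (a b c s : R) (u : R -> R) : Prop :=
  C2_on_pos u /\
  (forall r : R, 0 < r ->
     Derive_n u 2 r + 2 / r * Derive u r - 6 / r ^ 2 * u r = bulkF a b c (u r)) /\
  filterlim u (at_right 0) (locally 0) /\
  is_lim u p_infty s.

Definition w_of (u : R -> R) (r : R) : R := r * Derive u r / u r.

(* Main.v *)
(* Writing [t = ln r], [w = r u' / u] and [X = r^2 f(u)], the equation becomes
   the system [u_t = u w], [w_t = X - (w - 2)(w + 3)].

   Positivity and monotonicity.  Near 0 the term [6 / r^2] forces [u u' > 0].
   At a first turning point [r0] one has [6 / r0^2 + f(u) <= 0]; from then on the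
   energy [u'^2 / 2 - (V(u, r) - V(sigma(r), r))], where [sigma(r)] is the
   well of the potential [V(v, r)] with [V_v = v (6 / r^2 + f(v))], is negative and
   decreasing while [|u| < sigma].  It is nonnegative where [u = sigma] and
   tends to a nonnegative limit if [u -> s]; an exit through [- sigma] is final.
   So there is no turning point.

   Inequalities.  The three refined bounds amount to
   [eta < 0], [Z > 0] and [kappa > 0] with
   [eta = (X - (w - 2)(2 w + 3)) / w], [Z = X - 3 (w - 2)(w + 1)] and
   [kappa = (2 a^2 + b^2 u / 3) w + 2 f(u)]; the first inequality of the
   theorem is [u Z / r^2 >= 0].  Both [eta] and [Z] tend to 0 at [r = 0].
   At a critical point with [eta >= 0] (resp. [Z <= 0]) the second derivative
   of [eta] is positive (resp. that of [Z] negative), so a sign violation would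
   persist with a uniform gap up to infinity, which the system forbids.
   Finally [eta < 0] makes [kappa / (w r^2 u)] strictly decreasing, and a
   nonpositive value is incompatible with [f(u) -> 0]. *)

Require Import Defs.
From Stdlib Require Import Reals Lra.
From Coquelicot Require Import Coquelicot.
Open Scope R_scope.

(** * Calculus on the line *)

Lemma is_derive_continuity_pt (g : R -> R) (x l : R) :
  is_derive g x l -> continuity_pt g x.
Proof.
intros H; apply continuity_pt_filterlim.
apply (ex_derive_continuous g x); now exists l.
Qed.

Lemma derive_nonneg_le (g dg : R -> R) (a b : R) : a <= b ->
  (forall x, a <= x <= b -> is_derive g x (dg x)) ->
  (forall x, a <= x <= b -> 0 <= dg x) -> g a <= g b.
Proof.
intros ab Hg Hp.
destruct (MVT_gen g a b dg) as [c [Hc E]];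
  rewrite ?Rmin_left, ?Rmax_right in * by lra.
- intros x Hx; apply Hg; lra.
- intros x Hx; eapply is_derive_continuity_pt, Hg; lra.
- assert (P := Hp c Hc); nra.
Qed.

Lemma derive_pos_lt (g dg : R -> R) (a b : R) : a < b ->
  (forall x, a <= x <= b -> continuity_pt g x) ->
  (forall x, a < x < b -> is_derive g x (dg x)) ->
  (forall x, a < x < b -> 0 < dg x) -> g a < g b.
Proof.
intros ab Hc Hg Hp.
(* The mean value point is only known to lie in the closed interval, so the derivative is extended
   by the positive value 1 at the endpoints. *)
destruct (MVT_gen g a b (fun x => if Rlt_dec a x then if Rlt_dec x b then dg x
   else 1 else 1)) as [c [Ic E]]; rewrite ?Rmin_left, ?Rmax_right in * by lra.
- intros x Hx; destruct (Rlt_dec a x); [|lra]; destruct (Rlt_dec x b); [|lra].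
  now apply Hg.
- exact Hc.
- assert (P : 0 < (if Rlt_dec a c then if Rlt_dec c b then dg c else 1 else 1)).
  { destruct (Rlt_dec a c); [|lra]; destruct (Rlt_dec c b); [|lra].
    now apply Hp. }
  nra.
Qed.

Lemma derive_pos_local (g : R -> R) (T l : R) : is_derive g T l -> 0 < l ->
  exists d, 0 < d /\ (forall x, T - d < x < T -> g x < g T) /\
    (forall x, T < x < T + d -> g T < g x).
Proof.
intros H Hl; apply is_derive_Reals in H.
destruct (H (l / 2)) as [[d Hd] P]; [lra|]; simpl in P.
exists d; split; [exact Hd|].
assert (Q : forall x, x <> T -> T - d < x < T + d ->
   0 < (g x - g T) / (x - T)).
{ intros x xT Hx.
  assert (A := P (x - T)); replace (T + (x - T)) with x in A by ring.
  assert (B : Rabs ((g x - g T) / (x - T) - l) < l / 2).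
  { apply A; [lra|]; apply Rabs_def1; lra. }
  apply Rabs_def2 in B; lra. }
split; intros x Hx.
- assert (B := Q x ltac:(lra) ltac:(lra)).
  assert (g x - g T = (g x - g T) / (x - T) * (x - T)) by (field; lra); nra.
- assert (B := Q x ltac:(lra) ltac:(lra)).
  assert (g x - g T = (g x - g T) / (x - T) * (x - T)) by (field; lra); nra.
Qed.

(** [T] is the supremum of the points up to which [g] stays positive; continuity excludes both signs
    of [g T]. *)
Lemma first_zero (g : R -> R) (a b : R) : a < b ->
  (forall x, a <= x <= b -> continuity_pt g x) -> 0 < g a -> g b <= 0 ->
  exists T, a < T <= b /\ g T = 0 /\ forall x, a <= x < T -> 0 < g x.
Proof.
intros ab Hc ga gb.
set (E := fun x => a <= x <= b /\ forall y, a <= y <= x -> 0 < g y).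
assert (Ea : E a).
{ split; [lra|]; intros y Hy; now replace y with a by lra. }
destruct (completeness E) as [T [ub lub]].
{ exists b; intros x [Hx _]; lra. }
{ now exists a. }
assert (aT : a <= T) by now apply ub.
assert (Tb : T <= b) by (apply lub; intros x [Hx _]; lra).
assert (below : forall x, a <= x < T -> 0 < g x).
{ intros x Hx; destruct (Rlt_dec 0 (g x)) as [|N]; [easy|exfalso].
  assert (T <= x); [|lra].
  apply lub; intros y [Hy Py]; destruct (Rle_dec y x); [easy|].
  exfalso; apply N, Py; lra. }
assert (loc : forall eps, 0 < eps -> exists d, 0 < d /\
  forall x, Rabs (x - T) < d -> Rabs (g x - g T) < eps).
{ intros eps He; destruct (Hc T ltac:(lra) eps He) as [d [Hd P]].
  exists d; split; [exact Hd|]; intros x Hx.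
  destruct (Req_dec x T) as [->|n].
  - now rewrite Rminus_diag, Rabs_R0.
  - apply P; split; [split; [exact I|now apply not_eq_sym]|exact Hx]. }
destruct (Rtotal_order (g T) 0) as [N|[Z|P]].
- destruct (loc (- g T)) as [d [Hd Q]]; [lra|].
  assert (a < T).
  { destruct (Req_dec a T) as [e|]; [rewrite <- e in N|]; lra. }
  set (x := Rmax a (T - d / 2)).
  assert (Hx : a <= x < T /\ T - d < x).
  { unfold x; assert (A1 := Rmax_l a (T - d / 2)).
    assert (A2 := Rmax_r a (T - d / 2)).
    repeat split; try lra; apply Rmax_lub_lt; lra. }
  assert (A := below x ltac:(lra)).
  assert (B : Rabs (g x - g T) < - g T) by (apply Q, Rabs_def1; lra).
  apply Rabs_def2 in B; lra.
- exists T; repeat split; try easy.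
  destruct (Req_dec a T) as [e|]; [rewrite <- e in Z|]; lra.
- assert (T < b).
  { destruct (Req_dec T b) as [e|]; [rewrite e in P|]; lra. }
  destruct (loc (g T)) as [d [Hd Q]]; [lra|].
  set (x := Rmin b (T + d / 2)).
  assert (Hx : T < x <= b /\ x < T + d).
  { unfold x; assert (A1 := Rmin_l b (T + d / 2)).
    assert (A2 := Rmin_r b (T + d / 2)).
    repeat split; try lra; apply Rmin_glb_lt; lra. }
  assert (x <= T); [|lra].
  apply ub; split; [lra|]; intros y Hy.
  destruct (Rlt_dec y T); [apply below; lra|].
  assert (B : Rabs (g y - g T) < g T) by (apply Q, Rabs_def1; lra).
  apply Rabs_def2 in B; lra.
Qed.

Lemma derive_nonpos_at_first_zero (g : R -> R) (a T l : R) : a < T ->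
  is_derive g T l -> g T = 0 -> (forall x, a <= x < T -> 0 < g x) -> l <= 0.
Proof.
intros aT D Z P; destruct (Rle_dec l 0) as [|N]; [easy|exfalso].
destruct (derive_pos_local g T l D ltac:(lra)) as [d [Hd [Q _]]].
set (x := Rmax a (T - d / 2)).
assert (Hx : a <= x < T /\ T - d < x).
{ unfold x; assert (A1 := Rmax_l a (T - d / 2)).
  assert (A2 := Rmax_r a (T - d / 2)).
  repeat split; try lra; apply Rmax_lub_lt; lra. }
assert (A := P x ltac:(lra)); assert (B := Q x ltac:(lra)); lra.
Qed.

(** Covers [g a = 0]: the positive slope makes [g] positive just after [a], where [first_zero] can
    start. *)
Lemma first_zero_after (g : R -> R) (a b l : R) : a < b ->
  (forall x, a <= x <= b -> continuity_pt g x) ->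
  is_derive g a l -> 0 < l -> 0 <= g a -> g b <= 0 ->
  exists T, a < T <= b /\ g T = 0 /\ forall x, a < x < T -> 0 < g x.
Proof.
intros ab Hc D Hl ga gb.
destruct (derive_pos_local g a l D Hl) as [d [Hd [_ P]]].
set (a' := Rmin ((a + b) / 2) (a + d / 2)).
assert (Ha : a < a' < b /\ a' < a + d).
{ unfold a'; assert (A1 := Rmin_l ((a + b) / 2) (a + d / 2)).
  assert (A2 := Rmin_r ((a + b) / 2) (a + d / 2)).
  repeat split; try lra; apply Rmin_glb_lt; lra. }
destruct (first_zero g a' b) as [T [HT [Z Q]]]; try lra.
{ intros x Hx; apply Hc; lra. }
{ assert (A := P a' ltac:(lra)); lra. }
exists T; repeat split; try lra.
intros x Hx; destruct (Rlt_dec x a'); [|apply Q; lra].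
assert (A := P x ltac:(lra)); lra.
Qed.

(* If [D] can vanish only while increasing as long as [eta >= 0], then [eta]
   cannot turn down once it is nonnegative and nondecreasing. *)
Lemma increasing_trap (eta D D' : R -> R) (t0 : R) :
  (forall t, is_derive eta t (D t)) -> (forall t, is_derive D t (D' t)) ->
  (forall t, 0 <= eta t -> D t = 0 -> 0 < D' t) ->
  0 <= eta t0 -> 0 <= D t0 -> forall t, t0 < t -> 0 < D t.
Proof.
intros He HD HD' e0 D0 t1 Ht; apply Rnot_le_lt; intros N.
assert (Dc : forall x, continuity_pt D x)
  by (intros x; exact (is_derive_continuity_pt _ _ _ (HD x))).
assert (Z : exists T, t0 < T <= t1 /\ D T = 0 /\ forall x, t0 < x < T -> 0 < D x).
{ destruct (Req_dec (D t0) 0) as [Z|n].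
  - apply (first_zero_after D t0 t1 (D' t0)); auto.
  - destruct (first_zero D t0 t1) as [T [HT [Z P]]]; auto; try lra.
    exists T; repeat split; try lra; intros x Hx; apply P; lra. }
destruct Z as [T [HT [Z Q]]].
assert (pos : forall x, t0 <= x <= T -> 0 <= D x).
{ intros x Hx; destruct (Req_dec x t0) as [->|]; [easy|].
  destruct (Req_dec x T) as [->|]; [lra|].
  apply Rlt_le, Q; lra. }
(* Since [D >= 0] up to [T], [eta T >= 0], hence [D' T > 0]; but [D] comes down to its zero [T] from
   positive values. *)
assert (eT : eta t0 <= eta T).
{ apply (derive_nonneg_le eta D); auto; lra. }
assert (A := HD' T ltac:(lra) Z).
assert (B := derive_nonpos_at_first_zero D ((t0 + T) / 2) T _ ltac:(lra) (HD T) Z).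
cut (D' T <= 0); [lra|]; apply B; intros x Hx; apply Q; lra.
Qed.

Lemma derive_pos_lt_everywhere (g dg : R -> R) (a b : R) : a < b ->
  (forall x, is_derive g x (dg x)) ->
  (forall x, a < x < b -> 0 < dg x) -> g a < g b.
Proof.
intros ab Hg Hp; apply (derive_pos_lt g dg); auto.
intros x _; exact (is_derive_continuity_pt _ _ _ (Hg x)).
Qed.

(** If [D t1 >= 0], the trap keeps [eta] increasing after [t1]. Otherwise the trap for the
    time-reversed function makes [eta] decreasing up to [t1], so that it stays above a positive
    constant near minus infinity, against the hypothesis there. *)
Lemma escape_of_nonneg (eta D D' : R -> R) (t1 : R) :
  (forall t, is_derive eta t (D t)) -> (forall t, is_derive D t (D' t)) ->
  (forall t, 0 <= eta t -> D t = 0 -> 0 < D' t) ->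
  (forall p, 0 < p -> exists t0, forall t, t <= t0 -> eta t < p) ->
  0 <= eta t1 -> exists t2 p, 0 < p /\ forall t, t2 <= t -> p <= eta t.
Proof.
intros He HD HD' Hlim e1; destruct (Rle_dec 0 (D t1)) as [d1|d1].
- assert (pos := increasing_trap eta D D' t1 He HD HD' e1 d1).
  exists (t1 + 1), (eta (t1 + 1)); split.
  + apply (Rle_lt_trans _ _ _ e1).
    apply (derive_pos_lt_everywhere eta D); auto; [lra|].
    intros x Hx; apply pos; lra.
  + intros t Ht; apply (derive_nonneg_le eta D); auto.
    intros x Hx; apply Rlt_le, pos; lra.
- exfalso.
  assert (neg : forall t, - t1 < t -> 0 < - D (- t)).
  { apply (increasing_trap (fun x => eta (- x)) _ (fun x => D' (- x)));
      rewrite ?Ropp_involutive; try lra.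
    - intros x; auto_derive; [now eexists; apply He|].
      rewrite (is_derive_unique (fun x : R => eta x) _ _ (He (- x))); ring.
    - intros x; auto_derive; [now eexists; apply HD|].
      rewrite (is_derive_unique (fun x : R => D x) _ _ (HD (- x))); ring.
    - intros x P Q; apply HD'; lra. }
  assert (decr : forall x y, x < y <= t1 -> eta y < eta x).
  { intros x y H; apply Ropp_lt_cancel.
    apply (derive_pos_lt_everywhere (fun t => - eta t) (fun t => - D t)); [lra| |].
    - intros z; apply (is_derive_opp eta z _ (He z)).
    - intros z Hz; rewrite <- (Ropp_involutive z); apply neg; lra. }
  assert (A := decr (t1 - 1) t1 ltac:(lra)).
  destruct (Hlim (eta (t1 - 1)) ltac:(lra)) as [t0 P].
  set (x := Rmin (t1 - 2) t0).
  assert (B := P x (Rmin_r _ _)); assert (C := Rmin_l (t1 - 2) t0).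
  assert (E := decr x (t1 - 1) ltac:(unfold x; lra)); lra.
Qed.

(** * The reduced bulk nonlinearity and the logarithmic system *)

(** This is [f] for [al = a^2], [be = b^2 / 3], [ga = 2 c^2 / 3]. *)
Definition quad (al be ga v : R) : R := - al - be * v + ga * v ^ 2.

Lemma exp_nondecreasing (x y : R) : x <= y -> exp x <= exp y.
Proof.
intros [H| ->]; [apply Rlt_le, exp_increasing, H|apply Rle_refl].
Qed.

Lemma exp_small (k C p : R) : 0 < k -> 0 < p ->
  exists t0, forall t, t <= t0 -> C * exp (k * t) < p.
Proof.
intros hk hp; set (C' := Rabs C + 1).
assert (hC : C < C' /\ 0 < C').
{ unfold C'; assert (A1 := Rle_abs C); assert (A2 := Rabs_pos C); lra. }
exists (ln (p / C') / k); intros t ht.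
assert (P : 0 < exp (k * t)) by apply exp_pos.
assert (Q : exp (k * t) <= p / C').
{ rewrite <- (exp_ln (p / C')); [|apply Rdiv_lt_0_compat; lra].
  apply exp_nondecreasing; replace (ln (p / C')) with (k * (ln (p / C') / k))
    by (field; lra); nra. }
apply (Rlt_le_trans _ (C' * exp (k * t))); [nra|].
apply (Rle_trans _ (C' * (p / C'))); [nra|].
apply Req_le; field; lra.
Qed.

(* [U t = u (exp t)] and [W = U' / U] for a positive increasing solution [u]
   staying below the zero [s] of the nonlinearity. *)
Definition log_orbit (al be ga s : R) (U W : R -> R) : Prop :=
  (forall t, is_derive U t (U t * W t)) /\
  (forall t, is_derive W t
     (exp (2 * t) * quad al be ga (U t) - (W t - 2) * (W t + 3))) /\
  (forall t, 0 < U t < s) /\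
  (forall t, quad al be ga (U t) < 0) /\
  (forall t, 0 < W t < 2).

(* The side conditions are dispatched on the head function: letting [apply]
   choose between two derivative hypotheses triggers very slow unification. *)
Ltac ode_derive U HU W HW :=
  auto_derive;
  [ repeat match goal with
    | |- _ /\ _ => split
    | |- True => exact I
    | |- ex_derive (fun x => U x) _ => eexists; apply HU
    | |- ex_derive (fun x => W x) _ => eexists; apply HW
    end
  | rewrite ?(fun t => is_derive_unique (fun x : R => U x) t _ (HU t)),
      ?(fun t => is_derive_unique (fun x : R => W x) t _ (HW t)) ].

Section Orbit.
Context (al be ga s : R) (U W : R -> R).
Context (hal : 0 < al) (hbe : 0 <= be) (hga : 0 < ga).
Context (orbit : log_orbit al be ga s U W).

Lemma is_derive_orbit_U t : is_derive U t (U t * W t).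
Proof. apply orbit. Qed.

Lemma is_derive_orbit_W t : is_derive W t
  (exp (2 * t) * quad al be ga (U t) - (W t - 2) * (W t + 3)).
Proof. apply orbit. Qed.

Lemma orbit_U_bounds t : 0 < U t < s.
Proof. apply orbit. Qed.

Lemma orbit_quad_neg t : quad al be ga (U t) < 0.
Proof. apply orbit. Qed.

Lemma orbit_W_bounds t : 0 < W t < 2.
Proof. apply orbit. Qed.

Lemma orbit_quad_ge t : - (al + be * s) <= quad al be ga (U t).
Proof. assert (A := orbit_U_bounds t); unfold quad; nra. Qed.

(** With [C = al + be s] one has [(2 - W)' <= C e^(2t) - 3 (2 - W)]. The integrating factor [e^(3t)]
    makes [h] nondecreasing, and [h] tends to 0 at minus infinity, so [h >= 0]. *)
Lemma orbit_W_near_2 t : 2 - W t <= (al + be * s) / 5 * exp (2 * t).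
Proof.
set (C := al + be * s);
set (h := fun t => C / 5 * exp (5 * t) - exp (3 * t) * (2 - W t)).
assert (E5 : forall t, exp (5 * t) = exp (3 * t) * exp (2 * t)).
{ intros x; rewrite <- exp_plus; f_equal; ring. }
assert (mono : forall x y, x <= y -> h x <= h y).
{ intros x y xy.
  apply (derive_nonneg_le h (fun t => C * exp (5 * t) - exp (3 * t) *
    (3 * (2 - W t) - (exp (2 * t) * quad al be ga (U t) - (W t - 2) * (W t + 3))))); [easy| |].
  - intros z _; unfold h; ode_derive U is_derive_orbit_U W is_derive_orbit_W; field.
  - intros z _; rewrite E5; assert (A := orbit_quad_ge z).
    fold C in A; assert (B := orbit_W_bounds z).
    assert (P2 := exp_pos (2 * z)); assert (P3 := exp_pos (3 * z)).
    replace (_ - _) with (exp (3 * z) * (exp (2 * z) * (C + quad al be ga (U z))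
       + W z * (2 - W z))) by ring.
    apply Rmult_le_pos; [lra|]; apply Rplus_le_le_0_compat; nra. }
apply Rnot_lt_le; intros N.
assert (hn : 0 < - h t).
{ unfold h; rewrite E5; assert (P3 := exp_pos (3 * t)); nra. }
destruct (exp_small 3 2 (- h t)) as [t0 Q]; [lra|easy|].
set (x := Rmin t t0).
assert (A1 := mono x t (Rmin_l _ _)); assert (A2 := Q x (Rmin_r _ _)).
assert (A3 := orbit_U_bounds x); assert (B := orbit_W_bounds x);
assert (P3 := exp_pos (3 * x)).
assert (P5 := exp_pos (5 * x)).
assert (0 <= C) by (unfold C; nra).
unfold h at 1 in A1; nra.
Qed.

(** * The upper bound for [f]: [eta < 0] *)

(** Division by [W] is chosen so that [W' = W (eta + W - 2)]. *)
Definition orbit_eta t :=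
  (exp (2 * t) * quad al be ga (U t) - (W t - 2) * (2 * W t + 3)) / W t.

Definition orbit_deta t :=
  orbit_eta t * (5 - 3 * W t) - orbit_eta t ^ 2
  + (W t - 2) * (11 * W t + 6) / W t + (2 * al + be * U t) * exp (2 * t).

Lemma is_derive_orbit_eta t : is_derive orbit_eta t (orbit_deta t).
Proof.
assert (A := orbit_W_bounds t); unfold orbit_deta, orbit_eta, quad in *.
ode_derive U is_derive_orbit_U W is_derive_orbit_W; [lra|unfold quad; field; lra].
Qed.

Lemma orbit_W_eta t :
  exp (2 * t) * quad al be ga (U t) - (W t - 2) * (W t + 3) =
  W t * (orbit_eta t + W t - 2).
Proof. assert (A := orbit_W_bounds t); unfold orbit_eta; field; lra. Qed.

Definition orbit_ddeta t :=
  let w := W t in let e := orbit_eta t in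
  orbit_deta t * (5 - 3 * w - 2 * e)
  + (11 + 12 / w ^ 2 - 3 * e) * (w * (e + w - 2))
  + be * U t * w * exp (2 * t) + 2 * (2 * al + be * U t) * exp (2 * t).

Lemma is_derive_orbit_deta t : is_derive orbit_deta t (orbit_ddeta t).
Proof.
assert (A := orbit_W_bounds t); unfold orbit_ddeta; rewrite <- orbit_W_eta.
unfold orbit_deta at 1.
auto_derive.
- repeat match goal with
    | |- _ /\ _ => split
    | |- ex_derive (fun x => orbit_eta x) _ => eexists; apply is_derive_orbit_eta
    | |- ex_derive (fun x => U x) _ => eexists; apply is_derive_orbit_U
    | |- ex_derive (fun x => W x) _ => eexists; apply is_derive_orbit_W
    end; lra.
- rewrite (is_derive_unique (fun x : R => orbit_eta x) t _ (is_derive_orbit_eta t)),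
    (is_derive_unique (fun x : R => U x) t _ (is_derive_orbit_U t)),
    (is_derive_unique (fun x : R => W x) t _ (is_derive_orbit_W t)).
  field; lra.
Qed.

(** The equation [eta' = 0] eliminates [(2 al + be U) e^(2t)] from [eta'']. What remains is a sum of
    nonnegative terms, with [11 (w - 2)^2 > 0], once [f < 0] is used to bound [w eta] from above. *)
Lemma orbit_ddeta_pos t : 0 <= orbit_eta t -> orbit_deta t = 0 ->
  0 < orbit_ddeta t.
Proof.
intros e0 d0.
assert (A := orbit_W_bounds t); assert (B := orbit_U_bounds t);
assert (F := orbit_quad_neg t).
assert (P2 := exp_pos (2 * t)).
unfold orbit_ddeta; rewrite d0; unfold orbit_deta in d0.
assert (eub : W t * orbit_eta t < 6 + W t - 2 * W t ^ 2).
{ unfold orbit_eta; replace (W t * _) with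
    (exp (2 * t) * quad al be ga (U t) - (W t - 2) * (2 * W t + 3))
    by (field; lra); nra. }
clear F; set (w := W t) in *; set (e := orbit_eta t) in *.
set (r := exp (2 * t)) in *; set (x := U t) in *; clearbody w e r x.
assert (th : (2 * al + be * x) * r =
  e ^ 2 - e * (5 - 3 * w) - (w - 2) * (11 * w + 6) / w) by lra.
replace (2 * (2 * al + be * x) * r) with (2 * ((2 * al + be * x) * r)) by ring.
rewrite th.
replace (_ + _) with ((e * w * (e * w * (2 - 3 * w) + 12 - 10 * w + 23 * w ^ 2
   - 3 * w ^ 3)) / w ^ 2 + 11 * (w - 2) ^ 2 + be * x * w * r) by (field; lra).
assert (0 <= be * x * w * r) by (repeat apply Rmult_le_pos; lra).
assert (0 < 11 * (w - 2) ^ 2) by nra.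
assert (Q : 0 <= e * w * (2 - 3 * w) + 12 - 10 * w + 23 * w ^ 2 - 3 * w ^ 3).
(* The coefficient [2 - 3 w] of [e w] changes sign at [2 / 3]; beyond it, [e w] is replaced by its
   upper bound. *)
{ destruct (Rle_dec w (2 / 3)).
  - assert (0 <= e * w * (2 - 3 * w)) by (repeat apply Rmult_le_pos; lra); nra.
  - assert (e * w * (3 * w - 2) <= (6 + w - 2 * w ^ 2) * (3 * w - 2)) by nra.
    assert (0 <= 24 - 26 * w + 16 * w ^ 2 + 3 * w ^ 3) by nra.
    nra. }
assert (0 <= (e * w * (e * w * (2 - 3 * w) + 12 - 10 * w + 23 * w ^ 2
   - 3 * w ^ 3)) / w ^ 2).
{ apply Rdiv_le_0_compat; [|nra].
  repeat apply Rmult_le_pos; lra. }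
lra.
Qed.

(** The identity [v f'(v) = 2 f(v) + 2 al + be v] is the origin of the factor [2 al + be U] here and
    in the other derivatives. *)
Lemma is_derive_orbit_X t :
  is_derive (fun t => exp (2 * t) * quad al be ga (U t)) t
   (2 * (exp (2 * t) * quad al be ga (U t)) * (1 + W t)
    + (2 * al + be * U t) * (W t * exp (2 * t))).
Proof. unfold quad; ode_derive U is_derive_orbit_U W is_derive_orbit_W; field. Qed.

Lemma orbit_near_minfty (C p : R) : 0 < p ->
  exists t0, forall t, t <= t0 -> 1 < W t /\ C * exp (2 * t) < p.
Proof.
intros hp.
destruct (exp_small 2 ((al + be * s) / 5) 1) as [ta Pa]; [lra|lra|].
destruct (exp_small 2 C p) as [tb Pb]; [lra|lra|].
exists (Rmin ta tb); intros t Ht.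
assert (A1 := Rmin_l ta tb); assert (A2 := Rmin_r ta tb).
assert (A3 := orbit_W_near_2 t).
assert (A4 := Pa t ltac:(lra)); assert (A5 := Pb t ltac:(lra)); lra.
Qed.

(** Otherwise [eta >= eta0 > 0] from some time on. Then [p = W e^(2t)], which satisfies
    [p' = p (eta + W)], grows at least linearly, and the term [(2 al + be U) p] of [X'] drives [X]
    out of the interval from -7 to 0 that confines it. *)
Lemma orbit_eta_neg t : orbit_eta t < 0.
Proof.
apply Rnot_le_lt; intros N.
destruct (escape_of_nonneg _ _ _ t is_derive_orbit_eta is_derive_orbit_deta
  orbit_ddeta_pos) as [t2 [eta0 [h0 hge]]]; [|easy|].
{ clear N t; intros q hq;
  (* For [1 < W < 2], [f < 0] gives only [W eta <= (2 - W)(2 W + 3)], which is at most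
     [7 (2 - W)]. *)
  destruct (orbit_near_minfty (7 * ((al + be * s) / 5)) q hq) as [t0 P].
  exists t0; intros x Hx; destruct (P x Hx) as [P1 P2].
  assert (A := orbit_W_near_2 x); assert (B := orbit_W_bounds x).
  assert (C := orbit_quad_neg x); assert (D := exp_pos (2 * x)).
  apply Rnot_le_lt; intros Q.
  assert (E : W x * orbit_eta x <= (2 - W x) * (2 * W x + 3)).
  { unfold orbit_eta; replace (W x * _) with
      (exp (2 * x) * quad al be ga (U x) - (W x - 2) * (2 * W x + 3))
      by (field; lra); nra. }
  assert ((2 - W x) * (2 * W x + 3) < q) by nra.
  nra. }
clear N t; set (p := fun t => W t * exp (2 * t)).
assert (ppos : forall t, 0 < p t).
{ intros t; apply Rmult_lt_0_compat; [apply orbit_W_bounds|apply exp_pos]. }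
assert (Dp : forall t, is_derive p t (p t * (orbit_eta t + W t))).
{ intros t; unfold p; ode_derive U is_derive_orbit_U W is_derive_orbit_W;
  rewrite orbit_W_eta; field. }
assert (pm : forall t, t2 <= t -> p t2 <= p t).
{ intros t Ht; apply (derive_nonneg_le _ _ _ _ Ht (fun x _ => Dp x)).
  intros x Hx; assert (A := orbit_W_bounds x); assert (B := hge x ltac:(lra)).
  assert (C := ppos x); apply Rmult_le_pos; lra. }
set (k := p t2 * eta0).
assert (hk : 0 < k) by (apply Rmult_lt_0_compat; auto).
assert (plin : forall t, t2 <= t -> p t2 - k * t2 <= p t - k * t).
{ intros t Ht.
  apply (derive_nonneg_le (fun t => p t - k * t)
    (fun t => p t * (orbit_eta t + W t) - k)); [easy| |].
  - intros x _; auto_derive; [now eexists; apply Dp|].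
    rewrite (is_derive_unique (fun x : R => p x) _ _ (Dp x)); ring.
  - intros x Hx; assert (A := orbit_W_bounds x); assert (B := hge x ltac:(lra)).
    assert (C := pm x ltac:(lra)); assert (C' := ppos t2).
    unfold k; nra. }
(* The value 43 is [2 * 7 * 3 + 1]: since [X > -7] and [1 + W < 3], it makes [X' >= 1] after
   [t3]. *)
set (t3 := t2 + 43 / (2 * al * k)).
assert (H3 : 0 < 43 / (2 * al * k)).
{ apply Rdiv_lt_0_compat; [|apply Rmult_lt_0_compat]; lra. }
assert (plarge : forall t, t3 <= t -> 43 <= 2 * al * p t).
{ intros t Ht; assert (A := plin t ltac:(unfold t3 in Ht; lra)).
  assert (B := ppos t2).
  assert (E : 2 * al * (k * (t3 - t2)) = 43).
  { unfold t3; field; split; lra. }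
  assert (k * (t3 - t2) <= p t) by nra.
  nra. }
set (X := fun t => exp (2 * t) * quad al be ga (U t)).
(* The minimum of [(w - 2)(2 w + 3)] is [-49 / 8]. *)
assert (Xlow : forall t, t2 <= t -> -7 < X t).
{ intros t Ht; assert (A := orbit_W_bounds t); assert (B := hge t Ht).
  unfold X; replace (exp (2 * t) * quad al be ga (U t)) with
   (W t * orbit_eta t + (W t - 2) * (2 * W t + 3)) by
   (unfold orbit_eta; field; lra); nra. }
assert (Xneg : forall t, X t < 0).
{ intros t; assert (A := orbit_quad_neg t); assert (B := exp_pos (2 * t)).
  unfold X; nra. }
(* A rise of at least 8 from above -7 contradicts [X < 0]. *)
assert (step : X t3 - 1 * t3 <= X (t3 + 8) - 1 * (t3 + 8)).
{ apply (derive_nonneg_le (fun t => X t - 1 * t)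
   (fun t => 2 * X t * (1 + W t) + (2 * al + be * U t) * p t - 1)); [lra| |].
  - intros x _; auto_derive; [now eexists; apply is_derive_orbit_X|].
    rewrite (is_derive_unique (fun x : R => X x) _ _ (is_derive_orbit_X x)).
    unfold X, p; ring.
  - intros x Hx; assert (A := orbit_W_bounds x);
    assert (B := Xlow x ltac:(unfold t3 in *; lra)).
    assert (C := plarge x ltac:(lra)); assert (D := orbit_U_bounds x);
    assert (C' := ppos x).
    assert (Q := Xneg x).
    assert (0 <= be * U x * p x) by (apply Rmult_le_pos; nra).
    nra. }
assert (A := Xneg (t3 + 8)); assert (B := Xlow t3 ltac:(unfold t3; lra)).
lra.
Qed.

(** * The bound involving [2 a^2 + b^2 u / 3]: [kappa > 0] *)

Lemma orbit_U_le x y : x <= y -> U x <= U y.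
Proof.
intros xy; apply (derive_nonneg_le _ _ _ _ xy (fun z _ => is_derive_orbit_U z)).
intros z _; assert (A := orbit_U_bounds z); assert (B := orbit_W_bounds z); nra.
Qed.

(** A nonpositive value makes the decreasing quotient [L] stay below some [- d < 0]. Then [W] is at
    most of order [e^(-2t) |f|], so the relative decay rate of [|f|] is integrable in time and [f]
    cannot tend to 0. *)
Lemma orbit_kappa_pos t :
  (forall eps, 0 < eps -> exists T, forall x, T <= x ->
     - eps < quad al be ga (U x)) ->
  0 < (2 * al + be * U t) * W t + 2 * quad al be ga (U t).
Proof.
intros Hlim; apply Rnot_le_lt; intros N.
set (kap := fun t => (2 * al + be * U t) * W t + 2 * quad al be ga (U t)) in *.
set (den := fun t => W t * exp (2 * t) * U t).
assert (dpos : forall t, 0 < den t).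
{ intros x; assert (A := orbit_W_bounds x); assert (B := orbit_U_bounds x);
  assert (C := exp_pos (2 * x)).
  repeat apply Rmult_lt_0_compat; lra. }
set (L := fun t => kap t / den t).
assert (DL : forall t, is_derive L t
  (- (2 * al * W t ^ 2 + 2 * orbit_eta t * quad al be ga (U t)) / den t)).
{ intros x; assert (A := orbit_W_bounds x); assert (B := orbit_U_bounds x);
  assert (C := exp_pos (2 * x)).
  unfold L, kap, den, orbit_eta, quad;
  ode_derive U is_derive_orbit_U W is_derive_orbit_W.
  - repeat apply Rmult_integral_contrapositive_currified; lra.
  - unfold quad; field; lra. }
assert (Lneg : forall t, - (2 * al * W t ^ 2 + 2 * orbit_eta t * quad al be ga (U t)) / den t < 0).
{ intros x; assert (A := orbit_W_bounds x); assert (B := orbit_eta_neg x);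
  assert (C := orbit_quad_neg x).
  assert (E := dpos x); apply Ropp_lt_cancel; rewrite Ropp_0.
  replace (- _) with ((2 * al * W x ^ 2 + 2 * (orbit_eta x * quad al be ga (U x))) / den x)
    by (field; lra).
  apply Rdiv_lt_0_compat; [|easy].
  assert (0 < W x ^ 2) by nra.
  assert (0 < orbit_eta x * quad al be ga (U x)) by nra.
  nra. }
assert (Ldecr : forall x y, x < y -> L y < L x).
{ intros x y xy; apply Ropp_lt_cancel.
  apply (derive_pos_lt (fun t => - L t) (fun t => - (- (2 * al * W t ^ 2
     + 2 * orbit_eta t * quad al be ga (U t)) / den t))); [easy| | |].
  - intros z _; apply continuity_pt_opp.
    exact (is_derive_continuity_pt _ _ _ (DL z)).
  - intros z _; apply (is_derive_opp L z _ (DL z)).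
  - intros z _; assert (A := Lneg z); lra. }
assert (Lt : L t <= 0).
{ unfold L; assert (A := dpos t); apply Ropp_le_cancel; rewrite Ropp_0.
  replace (- _) with ((- kap t) / den t) by (field; lra).
  apply Rdiv_le_0_compat; [|easy]; unfold kap; lra. }
(* Strict decrease turns [L t <= 0] into a strictly negative value one unit later. *)
set (t1 := t + 1); set (d := - L t1).
assert (hd : 0 < d) by (assert (A := Ldecr t t1 ltac:(unfold t1; lra)); unfold d;
lra).
assert (u1 := proj1 (orbit_U_bounds t1)).
set (cc := 2 * (2 * al + be * s) / (d * U t1)).
assert (hcc : 0 <= cc).
{ assert (A := orbit_U_bounds t1); apply Rdiv_le_0_compat; [nra|].
  apply Rmult_lt_0_compat; lra. }
assert (bound : forall x, t1 <= x ->
  (2 * al + be * s) * W x <= - (cc * exp (- (2 * x)) * quad al be ga (U x))).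
{ intros x Hx.
  assert (A := orbit_W_bounds x); assert (B := orbit_U_bounds x);
  assert (C := exp_pos (2 * x)).
  assert (Lx : L x <= - d).
  { destruct (Req_dec x t1) as [->|]; [unfold d; lra|].
    assert (P := Ldecr t1 x ltac:(lra)); unfold d; lra. }
  assert (kx : kap x <= - d * den x).
  { replace (kap x) with (L x * den x) by (unfold L; field; assert (P := dpos x);
    lra).
    assert (P := dpos x); nra. }
  assert (Ux := orbit_U_le t1 x Hx).
  assert (dn : W x * exp (2 * x) * U t1 <= den x).
  { apply Rmult_le_compat_l; [apply Rmult_le_pos; lra|easy]. }
  assert (fx : d * (W x * exp (2 * x) * U t1) <= - 2 * quad al be ga (U x)).
  { unfold kap in kx; assert (0 <= (2 * al + be * U x) * W x).
    { apply Rmult_le_pos; [|lra]; apply Rplus_le_le_0_compat;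
       [|apply Rmult_le_pos]; lra. }
    nra. }
  rewrite exp_Ropp.
  replace ((2 * al + be * s) * W x) with
    ((2 * al + be * s) / (d * U t1) * / exp (2 * x) *
       (d * (W x * exp (2 * x) * U t1))) by (field; lra).
  replace (- _) with ((2 * al + be * s) / (d * U t1) * / exp (2 * x) *
       (- 2 * quad al be ga (U x))) by (unfold cc; field; lra).
  apply Rmult_le_compat_l; [|easy].
  apply Rmult_le_pos; [|apply Rlt_le, Rinv_0_lt_compat; lra].
  apply Rdiv_le_0_compat; [nra|apply Rmult_lt_0_compat; lra]. }
(* By [bound], [g = - f] satisfies [g' >= - cc e^(-2t) g]; the exponential is the corresponding
   integrating factor and never exceeds 1. *)
set (H := fun t => - quad al be ga (U t) * exp (- (cc / 2) * exp (- (2 * t)))).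
assert (Hmono : forall x, t1 <= x -> H t1 <= H x).
{ intros x Hx.
  apply (derive_nonneg_le H (fun t =>
   exp (- (cc / 2) * exp (- (2 * t))) * (- W t * (2 * al + be * U t + 2 * quad al be ga (U t))
     - cc * exp (- (2 * t)) * quad al be ga (U t)))); [easy| |].
  - intros z _; unfold H, quad; ode_derive U is_derive_orbit_U W is_derive_orbit_W;
    field.
  - intros z Hz; assert (A := bound z ltac:(lra)).
    assert (B := orbit_U_bounds z); assert (C := orbit_W_bounds z);
    assert (D := orbit_quad_neg z).
    apply Rmult_le_pos; [apply Rlt_le, exp_pos|].
    assert (W z * (2 * al + be * U z + 2 * quad al be ga (U z)) <= (2 * al + be * s) * W z).
    { rewrite (Rmult_comm (W z)); apply Rmult_le_compat_r; [lra|].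
      assert (be * U z <= be * s) by (apply Rmult_le_compat_l; lra); lra. }
    lra. }
assert (Hpos : 0 < H t1).
{ unfold H; assert (A := orbit_quad_neg t1).
  apply Rmult_lt_0_compat; [lra|apply exp_pos]. }
destruct (Hlim (H t1) Hpos) as [T PT].
set (x := Rmax t1 T).
assert (A := Hmono x (Rmax_l _ _)); assert (B := PT x (Rmax_r _ _)).
assert (C := orbit_quad_neg x).
assert (D : exp (- (cc / 2) * exp (- (2 * x))) <= 1).
{ rewrite <- exp_0; apply exp_nondecreasing; assert (P := exp_pos (- (2 * x))); nra. }
unfold H at 2 in A; nra.
Qed.

(** * The lower bound for [f]: [Z > 0] *)

(** In terms of [Z] the second equation of the system reads [W' = Z + 2 W (W - 2)]. *)
Definition orbit_Z t :=
  exp (2 * t) * quad al be ga (U t) - 3 * (W t - 2) * (W t + 1).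

Definition orbit_dZ t :=
  orbit_Z t * (5 - 4 * W t) + 6 * (W t - 2) * (1 + 3 * W t - W t ^ 2)
  + (2 * al + be * U t) * W t * exp (2 * t).

Definition orbit_ddZ t :=
  let w := W t in let z := orbit_Z t in
  orbit_dZ t * (5 - 4 * w)
  + (z + 2 * w * (w - 2)) * (- 4 * z + 6 * (- 3 * w ^ 2 + 10 * w - 5))
  + be * U t * w ^ 2 * exp (2 * t)
  + (2 * al + be * U t) * exp (2 * t) * (z + 2 * w * (w - 2) + 2 * w).

Lemma is_derive_orbit_Z t : is_derive orbit_Z t (orbit_dZ t).
Proof.
unfold orbit_dZ, orbit_Z, quad.
ode_derive U is_derive_orbit_U W is_derive_orbit_W; unfold quad; field.
Qed.

Lemma is_derive_orbit_dZ t : is_derive orbit_dZ t (orbit_ddZ t).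
Proof.
unfold orbit_ddZ, orbit_dZ, orbit_Z, quad.
ode_derive U is_derive_orbit_U W is_derive_orbit_W; unfold quad; field.
Qed.

(** As for [eta], the vanishing first derivative eliminates [(2 al + be U) e^(2t)]; then [- Z''] is
    a sum of terms that are nonnegative for [Z <= 0] and [0 < w < 2]. *)
Lemma orbit_ddZ_neg t : orbit_Z t <= 0 -> orbit_dZ t = 0 -> orbit_ddZ t < 0.
Proof.
intros z0 d0; assert (A := orbit_W_bounds t).
assert (P2 : 0 < al * exp (2 * t)) by
  (apply Rmult_lt_0_compat; [easy|apply exp_pos]).
unfold orbit_ddZ; rewrite d0; unfold orbit_dZ in d0.
set (w := W t) in *; set (z := orbit_Z t) in *.
set (r := exp (2 * t)) in *; set (x := U t) in *; clearbody w z r x.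
assert (th : (2 * al + be * x) * r =
  - (z * (5 - 4 * w) + 6 * (w - 2) * (1 + 3 * w - w ^ 2)) / w).
{ apply (Rmult_eq_reg_r w); [|lra].
  replace (_ / w * w) with (- (z * (5 - 4 * w)
    + 6 * (w - 2) * (1 + 3 * w - w ^ 2))) by (field; lra); lra. }
replace (be * x * w ^ 2 * r) with
  ((2 * al + be * x) * r * w ^ 2 - 2 * (al * r) * w ^ 2) by ring.
rewrite th.
replace (_ + _) with (- ((- z) * (- 5 * z + 12 + 10 * w + 23 * w ^ 2 - 8 * w ^ 3) / w
   + 6 * (w - 2) ^ 2 * (3 * w ^ 2 - 3 * w + 1) + 2 * (al * r) * w ^ 2)) by (field;
     lra).
apply Ropp_lt_cancel; rewrite Ropp_0, Ropp_involutive.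
assert (0 < w ^ 2) by nra.
assert (0 < (w - 2) ^ 2) by nra.
assert (0 < 3 * w ^ 2 - 3 * w + 1) by (assert (0 <= (w - 1 / 2) ^ 2) by apply pow2_ge_0; lra).
assert (0 <= (- z) * (- 5 * z + 12 + 10 * w + 23 * w ^ 2 - 8 * w ^ 3) / w).
{ apply Rdiv_le_0_compat; [|lra]; apply Rmult_le_pos; [lra|].
  assert (0 <= w ^ 2 * (23 - 8 * w)) by nra; nra. }
assert (0 < (w - 2) ^ 2 * (3 * w ^ 2 - 3 * w + 1)) by nra.
nra.
Qed.

(** Otherwise [Z <= - p < 0] from some time on, so [W' <= - p], which is impossible for a bounded
    [W]. *)
Lemma orbit_Z_pos t : 0 < orbit_Z t.
Proof.
apply Rnot_le_lt; intros N.
destruct (escape_of_nonneg (fun t => - orbit_Z t) (fun t => - orbit_dZ t)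
  (fun t => - orbit_ddZ t) t) as [t2 [p [hp hge]]]; try lra.
{ intros x; apply (is_derive_opp orbit_Z x _ (is_derive_orbit_Z x)). }
{ intros x; apply (is_derive_opp orbit_dZ x _ (is_derive_orbit_dZ x)). }
{ intros x Px Qx; assert (A := orbit_ddZ_neg x); lra. }
{ intros q hq; destruct (orbit_near_minfty (al + be * s) q hq) as [t0 P].
  exists t0; intros x Hx; destruct (P x Hx) as [P1 P2].
  assert (A := orbit_W_bounds x); assert (B := orbit_quad_ge x).
  assert (D := exp_pos (2 * x)); unfold orbit_Z; nra. }
(* During this time [W] would drop by 3, more than the length of its range. *)
set (T := t2 + 3 / p).
assert (HT : 0 < 3 / p) by (apply Rdiv_lt_0_compat; lra).
assert (A : - W t2 - p * t2 <= - W T - p * T).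
{ apply (derive_nonneg_le (fun t => - W t - p * t)
    (fun t => - (orbit_Z t + 2 * W t * (W t - 2)) - p)); [unfold T; lra| |].
  - intros x _; unfold orbit_Z; ode_derive U is_derive_orbit_U W is_derive_orbit_W;
    field.
  - intros x Hx; assert (B := orbit_W_bounds x); assert (C := hge x ltac:(lra));
    nra. }
assert (B := orbit_W_bounds t2); assert (C := orbit_W_bounds T).
replace (p * T) with (p * t2 + 3) in A by (unfold T; field; lra).
lra.
Qed.

End Orbit.

(** * Positivity and monotonicity of the radial solution *)

Section Radial.
Context (al be ga s : R) (u du : R -> R).
Context (hal : 0 < al) (hbe : 0 <= be) (hga : 0 < ga).
Context (hs : 0 < s) (qs : quad al be ga s = 0).
Context (Hu : forall r, 0 < r -> is_derive u r (du r)).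
Context (Hdu : forall r, 0 < r -> is_derive du r
  (u r * (6 / r ^ 2 + quad al be ga (u r)) - 2 / r * du r)).
Context (u_to_s : forall eps, 0 < eps -> exists T, forall r, T <= r ->
  Rabs (u r - s) < eps).

Let u_cont r (h : 0 < r) : continuity_pt u r :=
  is_derive_continuity_pt _ _ _ (Hu r h).
Let du_cont r (h : 0 < r) : continuity_pt du r :=
  is_derive_continuity_pt _ _ _ (Hdu r h).

Ltac solve_ex := repeat match goal with
    | |- _ /\ _ => split
    | |- True => exact I
    | |- ex_derive (fun x => u x) _ => eexists; apply Hu; assumption
    | |- ex_derive (fun x => du x) _ => eexists; apply Hdu; assumption
    end.

(* [v = - u] lies above the largest zero [sigma] of [6 / r ^ 2 + quad v] and
   moves away at least as fast as [sigma] does: [sigma' <= v'] reads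
   [12 <= quad' v * r ^ 3 * v'].  Both facts persist. *)
Lemma decreasing_below_barrier T : 0 < T -> u T < 0 ->
  0 <= 6 / T ^ 2 + quad al be ga (- u T) -> be < 2 * ga * - u T ->
  12 <= (2 * ga * - u T - be) * (T ^ 3 * - du T) ->
  forall r, T <= r -> u r <= u T.
Proof.
intros hT uT eT bT hT0.
(* The sign of [e] encodes the position relative to the barrier and that of [h] the comparison of
   speeds: [e' = h / r^3]. *)
set (e := fun r => 6 / r ^ 2 + quad al be ga (- u r)).
set (h := fun r => (2 * ga * - u r - be) * (r ^ 3 * - du r) - 12).
set (h' := fun r => 2 * ga * r ^ 3 * du r ^ 2 + (2 * ga * - u r - be) *
  (r ^ 2 * - du r + r ^ 3 * - u r * (6 / r ^ 2 + quad al be ga (u r)))).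
assert (Dh : forall r, 0 < r -> is_derive h r (h' r)).
{ intros r hr; unfold h, h'; auto_derive; [now solve_ex|].
  rewrite (is_derive_unique (fun x : R => u x) _ _ (Hu r hr)),
    (is_derive_unique (fun x : R => du x) _ _ (Hdu r hr)); field; lra. }
assert (De : forall r, 0 < r -> is_derive e r (h r / r ^ 3)).
{ intros r hr; unfold e, h, quad; auto_derive.
  - solve_ex; apply Rmult_integral_contrapositive_currified; nra.
  - rewrite (is_derive_unique (fun x : R => u x) _ _ (Hu r hr)); field; lra. }
(* While [h >= 0], [u'] cannot vanish, as [h] would be -12; so [u] decreases, [e] stays nonnegative,
   and this makes [h' > 0]. *)
assert (key : forall T2, (forall x, T <= x <= T2 -> 0 <= h x) ->
  forall x, T <= x <= T2 -> u x <= u T /\ 0 < h' x).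
{ intros T2 hpos.
  assert (duT : 0 < - du T).
  { assert (0 < T ^ 3) by now apply pow_lt.
    apply Rnot_le_lt; intros N; assert (T ^ 3 * - du T <= 0) by nra; nra. }
  assert (dneg : forall x, T <= x <= T2 -> 0 < - du x).
  { intros x Hx; destruct (Req_dec x T) as [->|n]; [easy|].
    apply Rnot_le_lt; intros N.
    destruct (first_zero (fun r => - du r) T x) as [y [Hy [Z _]]]; try lra.
    - intros z Hz; apply continuity_pt_opp, du_cont; lra.
    - assert (A := hpos y ltac:(lra)); unfold h in A; rewrite Z in A; lra. }
  assert (ule : forall x, T <= x <= T2 -> u x <= u T).
  { intros x Hx; apply Ropp_le_cancel.
    apply (derive_nonneg_le (fun r => - u r) (fun r => - du r)); [lra| |].
    - intros z Hz; apply (is_derive_opp u z _ (Hu z ltac:(lra))).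
    - intros z Hz; apply Rlt_le, dneg; lra. }
  intros x Hx; assert (A := ule x Hx); assert (B := dneg x Hx).
  split; [easy|].
  assert (ex : e T <= e x).
  { apply (derive_nonneg_le e (fun r => h r / r ^ 3)); [lra| |].
    - intros z Hz; apply De; lra.
    - intros z Hz; apply Rdiv_le_0_compat; [apply hpos; lra|].
      apply pow_lt; lra. }
  assert (ux : 0 <= 6 / x ^ 2 + quad al be ga (u x)).
  { replace (quad al be ga (u x)) with
      (quad al be ga (- u x) + 2 * (be * - u x)) by (unfold quad; ring).
    assert (0 <= be * - u x) by (apply Rmult_le_pos; lra).
    unfold e in ex; lra. }
  assert (x2 : 0 < x ^ 2) by (apply pow_lt; lra).
  assert (x3 : 0 < x ^ 3) by (apply pow_lt; lra).
  apply Rplus_lt_le_0_compat.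
  - assert (0 < du x ^ 2) by nra.
    apply Rmult_lt_0_compat; [apply Rmult_lt_0_compat|]; lra.
  - apply Rmult_le_pos; [nra|].
    apply Rplus_le_le_0_compat; [apply Rmult_le_pos; lra|].
    apply Rmult_le_pos; [apply Rmult_le_pos|]; lra. }
assert (h0 : 0 <= h T) by (unfold h; lra).
assert (h'T : 0 < h' T).
{ apply (key T); [|lra]; intros x Hx; now replace x with T by lra. }
assert (hall : forall r, T <= r -> 0 <= h r).
{ intros b Hb; apply Rnot_lt_le; intros N.
  assert (T < b) by (destruct Hb as [|E]; [easy|rewrite <- E in N; lra]).
  assert (hc : forall x, T <= x -> continuity_pt h x).
  { intros x Hx; apply (is_derive_continuity_pt _ _ (h' x)), Dh; lra. }
  destruct (first_zero_after h T b (h' T)) as [T2 [H2 [Z P]]]; auto; try lra.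
  { intros x Hx; apply hc; lra. }
  assert (pos : forall x, T <= x <= T2 -> 0 <= h x).
  { intros x Hx; destruct (Req_dec x T) as [->|]; [easy|].
    destruct (Req_dec x T2) as [->|]; [lra|]; apply Rlt_le, P; lra. }
  assert (h T < h T2); [|lra].
  apply (derive_pos_lt h h'); try lra.
  - intros x Hx; apply hc; lra.
  - intros x Hx; apply Dh; lra.
  - intros x Hx; apply (key T2 pos); lra. }
intros r Hr; apply (key r); [|lra]; intros x Hx; apply hall; lra.
Qed.

(** * The moving potential well and the energy *)

Let V v r := v ^ 2 * (- (al - 6 / r ^ 2) / 2 - be * v / 3 + ga * v ^ 2 / 4).

Lemma is_derive_potential (g : R -> R) (r dg : R) : 0 < r -> is_derive g r dg ->
  is_derive (fun r => V (g r) r) r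
    (g r * (6 / r ^ 2 + quad al be ga (g r)) * dg - 6 * g r ^ 2 / r ^ 3).
Proof.
intros hr Hg; unfold V, quad; auto_derive.
- repeat split; try (now exists dg).
  apply Rmult_integral_contrapositive_currified; nra.
- rewrite (is_derive_unique (fun x : R => g x) _ _ Hg); field; lra.
Qed.

(** Discriminant of [6 / r^2 + quad v] as a polynomial in [v], with larger root [sig r]. As [sqrt]
    is 0 on negative numbers, [sig] is [be / (2 ga)] where there is no real root. *)
Let disc r := be ^ 2 + 4 * ga * al - 24 * ga / r ^ 2.
Let sig r := (be + sqrt (disc r)) / (2 * ga).

Lemma sig_zero r : 0 <= disc r -> 6 / r ^ 2 + quad al be ga (sig r) = 0.
Proof.
intros h; assert (E := sqrt_sqrt _ h).
assert (E' : 2 * ga * sig r - be = sqrt (disc r)) by (unfold sig; field; lra).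
rewrite <- E' in E; unfold disc in E; unfold quad; nra.
Qed.

Lemma sig_ge r : be <= 2 * ga * sig r.
Proof.
assert (P := sqrt_pos (disc r)).
replace (2 * ga * sig r) with (be + sqrt (disc r)) by (unfold sig; field; lra).
lra.
Qed.

(** [s] is the larger root without the term [6 / r^2], and that term lowers the discriminant. *)
Lemma sig_le_s r : 0 < r -> sig r <= s.
Proof.
intros hr.
assert (A : be < ga * s).
{ unfold quad in qs; apply Rnot_le_lt; intros N; nra. }
assert (B : sqrt (disc r) <= 2 * ga * s - be).
{ rewrite <- (sqrt_Rsqr (2 * ga * s - be)) by nra.
  apply sqrt_le_1_alt; unfold Rsqr, disc.
  assert (0 <= 24 * ga / r ^ 2).
  { apply Rdiv_le_0_compat; [lra|now apply pow_lt]. }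
  unfold quad in qs; nra. }
unfold sig; apply (Rmult_le_reg_l (2 * ga)); [lra|].
replace (2 * ga * _) with (be + sqrt (disc r)) by (field; lra); lra.
Qed.

Lemma is_derive_sig r : 0 < r -> 0 < disc r ->
  is_derive sig r (12 / (sqrt (disc r) * r ^ 3)).
Proof.
intros hr hd; assert (P := sqrt_lt_R0 _ hd).
unfold sig, disc in *; auto_derive.
- repeat split; try easy.
  apply Rmult_integral_contrapositive_currified; nra.
- replace (be * (be * 1) + _ + _) with
    (be ^ 2 + 4 * ga * al - 24 * ga / r ^ 2) by (field; lra).
  field; lra.
Qed.

Lemma disc_of_neg r v : 0 < r ->
  6 / r ^ 2 + quad al be ga v <= 0 -> 0 <= disc r.
Proof.
intros hr h.
replace (disc r) with ((2 * ga * v - be) ^ 2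
  - 4 * ga * (6 / r ^ 2 + quad al be ga v)) by (unfold disc, quad; field; lra).
assert (A := pow2_ge_0 (2 * ga * v - be)); nra.
Qed.

Lemma disc_lt r1 r2 : 0 < r1 < r2 -> disc r1 < disc r2.
Proof.
intros H; unfold disc.
assert (A : / r2 ^ 2 < / r1 ^ 2).
{ apply Rinv_lt_contravar; [|nra].
  apply Rmult_lt_0_compat; apply pow_lt; lra. }
unfold Rdiv; nra.
Qed.

(** The root [sig r] is a critical point of the potential, whence the double factor. *)
Lemma potential_sub_sig r v : 0 <= disc r ->
  V v r - V (sig r) r = (v - sig r) ^ 2 *
   (ga * (v + sig r) ^ 2 - 2 * be / 3 * (2 * v + sig r)) / 4.
Proof.
intros hd; assert (E := sig_zero r hd); unfold quad in E.
unfold V; replace (al - 6 / r ^ 2) with (ga * sig r ^ 2 - be * sig r) by lra.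
field.
Qed.

(** [v] lies strictly between the roots [be / ga - sig r] and [sig r], and the first is at least
    [- sig r]. *)
Lemma below_sig r v : 0 <= disc r ->
  6 / r ^ 2 + quad al be ga v < 0 -> v ^ 2 < sig r ^ 2.
Proof.
intros hd h; assert (E := sig_zero r hd); assert (G := sig_ge r).
assert (F : (v - sig r) * (ga * (v + sig r) - be) < 0).
{ unfold quad in *; nra. }
assert (S : 0 <= sig r) by nra.
assert (- sig r < v < sig r); [|nra].
split; apply Rnot_le_lt; intros N.
- assert (ga * (v + sig r) <= 0) by nra; nra.
- assert (0 <= ga * (v + sig r) - be) by nra; nra.
Qed.

(** Between the roots, for [v < sig], [ga (v + sig) >= be]; the second factor of the difference is
    then at least [be (sig - v) / 3]. *)
Lemma potential_ge_sig r v : 0 < r ->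
  6 / r ^ 2 + quad al be ga v <= 0 -> V (sig r) r <= V v r.
Proof.
intros hr h; assert (hd := disc_of_neg r v hr h).
assert (A := potential_sub_sig r v hd).
assert (E := sig_zero r hd); assert (G := sig_ge r).
assert (F : (v - sig r) * (ga * (v + sig r) - be) <= 0).
{ unfold quad in *; nra. }
cut (v = sig r \/
  0 <= ga * (v + sig r) ^ 2 - 2 * be / 3 * (2 * v + sig r)).
{ intros [->|Q]; [lra|].
  assert (P := pow2_ge_0 (v - sig r)).
  assert (0 <= (v - sig r) ^ 2 * (ga * (v + sig r) ^ 2
    - 2 * be / 3 * (2 * v + sig r))) by now apply Rmult_le_pos.
  lra. }
destruct (Rtotal_order v (sig r)) as [H|[H|H]]; [right|now left|].
- assert (K : be <= ga * (v + sig r)) by nra.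
  assert (0 <= v + sig r) by (apply Rnot_lt_le; intros N; nra).
  assert (be * (v + sig r) <= ga * (v + sig r) ^ 2) by nra.
  nra.
- assert (0 < ga * (v + sig r) - be) by nra; exfalso; nra.
Qed.

(* [sig r] being critical for [V _ r], only the explicit [r]-dependence of the
   well depth contributes to the derivative, which gives it a sign when
   [|u| < sig]. *)
Let M r := du r ^ 2 / 2 - (V (u r) r - V (sig r) r).

Lemma is_derive_energy r : 0 < r -> 0 < disc r ->
  is_derive M r (- 2 * du r ^ 2 / r + 6 * (u r ^ 2 - sig r ^ 2) / r ^ 3).
Proof.
intros hr hd; assert (P := sqrt_lt_R0 _ hd).
pose (VU := fun r => V (u r) r); pose (VS := fun r => V (sig r) r).
assert (A : is_derive VU r (u r * (6 / r ^ 2 + quad al be ga (u r)) * du r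
  - 6 * u r ^ 2 / r ^ 3)) by exact (is_derive_potential u r _ hr (Hu r hr)).
assert (B : is_derive VS r (sig r * (6 / r ^ 2 + quad al be ga (sig r)) *
  (12 / (sqrt (disc r) * r ^ 3)) - 6 * sig r ^ 2 / r ^ 3))
  by exact (is_derive_potential sig r _ hr (is_derive_sig r hr hd)).
rewrite sig_zero in B by lra.
change (is_derive (fun r => du r ^ 2 / 2 - (VU r - VS r)) r
 (- 2 * du r ^ 2 / r + 6 * (u r ^ 2 - sig r ^ 2) / r ^ 3)).
clearbody VU VS sig.
auto_derive.
- solve_ex; match goal with
    | |- ex_derive (fun x => VU x) _ => eexists; exact A
    | |- ex_derive (fun x => VS x) _ => eexists; exact B
    end.
- rewrite (is_derive_unique (fun x : R => du x) _ _ (Hdu r hr)),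
   (is_derive_unique (fun x : R => VU x) _ _ A),
   (is_derive_unique (fun x : R => VS x) _ _ B); field; lra.
Qed.

(** Includes the point where the discriminant vanishes and the formula for [sig'] blows up; a
    turning point may sit exactly there. *)
Lemma sig_cont r : 0 < r -> continuity_pt sig r.
Proof.
intros hr; unfold sig, Rdiv.
apply (continuity_pt_mult (fun r => be + sqrt (disc r)) (fun _ => / (2 * ga)));
  [|now apply continuity_pt_const].
apply (continuity_pt_plus (fun _ => be) (fun r => sqrt (disc r)));
  [now apply continuity_pt_const|].
apply (continuity_pt_comp disc sqrt).
- apply (is_derive_continuity_pt _ _ (48 * ga / r ^ 3)).
  unfold disc; auto_derive; [|field; lra].
  apply Rmult_integral_contrapositive_currified; nra.
- apply continuity_pt_filterlim, continuous_sqrt.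
Qed.

Lemma potential_cont (g : R -> R) r : 0 < r -> continuity_pt g r ->
  continuity_pt (fun r => V (g r) r) r.
Proof.
intros hr hg.
assert (c : forall k, continuity_pt (fun _ : R => k) r)
  by (intros k; now apply continuity_pt_const).
assert (c6 : continuity_pt (fun r => - (al - 6 / r ^ 2) / 2) r).
{ apply (is_derive_continuity_pt _ _ (- 6 / r ^ 3)); auto_derive; [|field; lra].
  apply Rmult_integral_contrapositive_currified; nra. }
assert (g2 : continuity_pt (fun r => g r ^ 2) r).
{ apply (continuity_pt_mult g (fun r => g r * 1)); [easy|].
  now apply (continuity_pt_mult g (fun r => 1)). }
apply (continuity_pt_mult (fun r => g r ^ 2)
  (fun r => - (al - 6 / r ^ 2) / 2 - be * g r / 3 + ga * g r ^ 2 / 4)); [easy|].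
apply (continuity_pt_plus (fun r => - (al - 6 / r ^ 2) / 2 - be * g r / 3)
  (fun r => ga * g r ^ 2 / 4)).
- apply (continuity_pt_minus (fun r => - (al - 6 / r ^ 2) / 2)
    (fun r => be * g r / 3)); [easy|].
  apply (continuity_pt_mult (fun r => be * g r) (fun r => / 3)); [|easy].
  now apply (continuity_pt_mult (fun r => be) g).
- apply (continuity_pt_mult (fun r => ga * g r ^ 2) (fun r => / 4)); [|easy].
  now apply (continuity_pt_mult (fun r => ga) (fun r => g r ^ 2)).
Qed.

Lemma energy_cont r : 0 < r -> continuity_pt M r.
Proof.
intros hr; unfold M.
apply (continuity_pt_minus (fun r => du r ^ 2 / 2)
  (fun r => V (u r) r - V (sig r) r)).
- apply (continuity_pt_mult (fun r => du r ^ 2) (fun r => / 2));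
    [|now apply continuity_pt_const].
  apply (continuity_pt_mult du (fun r => du r * 1)); [now apply du_cont|].
  apply (continuity_pt_mult du (fun r => 1)); [now apply du_cont|].
  now apply continuity_pt_const.
- apply (continuity_pt_minus (fun r => V (u r) r) (fun r => V (sig r) r)).
  + now apply potential_cont, u_cont.
  + now apply potential_cont, sig_cont.
Qed.

Lemma energy_decreasing r1 r2 : 0 < r1 < r2 -> 0 <= disc r1 ->
  (forall r, r1 < r < r2 -> u r ^ 2 < sig r ^ 2) -> M r2 < M r1.
Proof.
intros H hd P; apply Ropp_lt_cancel.
apply (derive_pos_lt (fun r => - M r) (fun r => - (- 2 * du r ^ 2 / r
   + 6 * (u r ^ 2 - sig r ^ 2) / r ^ 3))); [lra| | |].
- intros x Hx; apply continuity_pt_opp, energy_cont; lra.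
- intros x Hx; apply (is_derive_opp M x), is_derive_energy; [lra|].
  assert (A := disc_lt r1 x ltac:(lra)); lra.
- intros x Hx; assert (A := P x Hx); assert (B := pow2_ge_0 (du x)).
  replace (- _) with (2 * du x ^ 2 / x + 6 * (sig x ^ 2 - u x ^ 2) / x ^ 3)
    by (field; lra).
  apply Rplus_le_lt_0_compat.
  + apply Rdiv_le_0_compat; lra.
  + apply Rdiv_lt_0_compat; [lra|apply pow_lt; lra].
Qed.

(* The energy [M] is negative after such a turning point, whereas it vanishes
   or is positive wherever [u] meets [sig] and in the limit [u -> s]. *)
Lemma no_turning_point r0 : 0 < r0 -> du r0 = 0 ->
  6 / r0 ^ 2 + quad al be ga (u r0) <= 0 -> False.
Proof.
intros h0 du0 e0.
assert (d0 := disc_of_neg r0 (u r0) h0 e0).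
assert (M0 : M r0 <= 0).
{ assert (A := potential_ge_sig r0 (u r0) h0 e0); unfold M; rewrite du0; lra. }
(* Since [u' = 0] at [r0], only the explicit term contributes: [6 / r^2 + f(u)] is strictly negative
   just after [r0], so [|u| < sig] there. *)
assert (De : is_derive (fun r => - (6 / r ^ 2 + quad al be ga (u r))) r0 (12 / r0 ^ 3)).
{ unfold quad; auto_derive.
  - solve_ex; apply Rmult_integral_contrapositive_currified; nra.
  - rewrite (is_derive_unique (fun x : R => u x) _ _ (Hu r0 h0)), du0.
    field; lra. }
destruct (derive_pos_local _ _ _ De) as [d [hd [_ P]]].
{ apply Rdiv_lt_0_compat; [lra|now apply pow_lt]. }
assert (discpos : forall r, r0 < r -> 0 < disc r).
{ intros r hr; assert (A := disc_lt r0 r ltac:(lra)); lra. }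
assert (sigpos : forall r, r0 < r -> 0 < sqrt (disc r) /\ 0 < sig r /\
  2 * ga * sig r - be = sqrt (disc r)).
{ intros r hr; assert (A := sqrt_lt_R0 _ (discpos r hr)); repeat split; [easy| |].
  - apply Rdiv_lt_0_compat; lra.
  - unfold sig; field; lra. }
set (r1 := r0 + d / 2).
assert (M1 : M r1 < 0).
{ apply (Rlt_le_trans _ (M r0)); [|easy].
  apply energy_decreasing; [unfold r1; lra|easy|].
  intros r Hr; apply below_sig; [apply Rlt_le, discpos; lra|].
  assert (A := P r ltac:(unfold r1 in Hr; lra)); lra. }
assert (hr1 : r0 < r1 < r0 + d) by (unfold r1; lra).
set (G := fun r => sig r ^ 2 - u r ^ 2).
assert (G1 : 0 < G r1).
{ unfold G; apply Rlt_0_minus, below_sig; [apply Rlt_le, discpos; lra|].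
  assert (A := P r1 ltac:(lra)); lra. }
assert (Gc : forall r, 0 < r -> continuity_pt G r).
{ assert (sq : forall g r, continuity_pt g r -> continuity_pt (fun r => g r ^ 2) r).
  { intros g r c; apply (continuity_pt_mult g (fun r => g r * 1)); [easy|].
    apply (continuity_pt_mult g (fun r => 1)); [easy|now apply continuity_pt_const]. }
  intros r hr; apply (continuity_pt_minus (fun r => sig r ^ 2) (fun r => u r ^ 2));
    apply sq; [now apply sig_cont|now apply u_cont]. }
assert (Gpos : forall r, r1 <= r -> 0 < G r).
{ intros b hb; apply Rnot_le_lt; intros N.
  assert (r1 < b) by (destruct hb as [|E]; [easy|rewrite <- E in N; lra]).
  destruct (first_zero G r1 b) as [T [HT [Z Q]]]; auto.
  { intros x Hx; apply Gc; lra. }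
  assert (MT : M T < 0).
  { apply (Rlt_trans _ (M r1)); [|easy].
    apply energy_decreasing; [lra|apply Rlt_le, discpos; lra|].
    intros r Hr; assert (A := Q r ltac:(lra)); unfold G in A; lra. }
  destruct (sigpos T ltac:(lra)) as [q0 [s0 qs0]].
  assert (F : (u T - sig T) * (u T + sig T) = 0) by (unfold G in Z; lra).
  (* At [u = sig] the energy reduces to [u'^2 / 2 >= 0], a contradiction. At [u = - sig] the barrier
     keeps [u] negative forever, against [u -> s]. *)
  destruct (Rmult_integral _ _ F) as [F'|F'].
  - replace (u T) with (sig T) in MT by lra.
    assert (A := pow2_ge_0 (du T)); unfold M in MT.
    replace (u T) with (sig T) in MT by lra; lra.
  - assert (sT : - u T = sig T) by lra.
    (* At its first zero [sig + u] has nonpositive slope, which is the speed condition of the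
       barrier. *)
    assert (slope : 12 / (sqrt (disc T) * T ^ 3) + du T <= 0).
    { apply (derive_nonpos_at_first_zero (fun r => sig r + u r) r1 T); try lra.
      - apply (is_derive_plus sig u).
        + apply is_derive_sig; [lra|apply discpos; lra].
        + apply Hu; lra.
      - intros x Hx; assert (A := Q x ltac:(lra)); unfold G in A.
        destruct (sigpos x ltac:(lra)) as [_ [B _]]; nra. }
    assert (T3 : 0 < T ^ 3) by (apply pow_lt; lra).
    assert (low := decreasing_below_barrier T ltac:(lra) ltac:(lra)).
    rewrite sT, sig_zero in low by (apply Rlt_le, discpos; lra).
    assert (K : 12 <= (2 * ga * sig T - be) * (T ^ 3 * - du T)).
    { rewrite qs0; assert (0 < sqrt (disc T) * T ^ 3) by nra.
      replace 12 with (12 / (sqrt (disc T) * T ^ 3) * (sqrt (disc T) * T ^ 3))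
        by (field; lra).
      nra. }
    destruct (u_to_s s hs) as [T0 PT].
    assert (A := low (Rle_refl 0) ltac:(lra) K (Rmax T T0) (Rmax_l _ _)).
    assert (B := PT (Rmax T T0) (Rmax_r _ _)); apply Rabs_def2 in B; lra. }
assert (Mneg : forall r, r1 <= r -> M r <= M r1).
{ intros r hr; destruct (Req_dec r r1) as [->|]; [lra|].
  apply Rlt_le, energy_decreasing; [lra|apply Rlt_le, discpos; lra|].
  intros x Hx; assert (A := Gpos x ltac:(lra)); unfold G in A; lra. }
(* [K] bounds the second factor of [potential_sub_sig]. As [u < sig <= s], the limit [u -> s]
   squeezes [sig - u] to 0, so the potential gap becomes smaller than [- M r1]. *)
set (K := 4 * ga * s ^ 2 + 2 * be * s).
assert (hK : 0 < K).
{ assert (0 < ga * s ^ 2) by (apply Rmult_lt_0_compat; nra).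
  assert (0 <= be * s) by (apply Rmult_le_pos; lra); unfold K; lra. }
destruct (u_to_s (Rmin 1 (- M r1 / K))) as [T0 PT].
{ apply Rmin_glb_lt; [lra|apply Rdiv_lt_0_compat; lra]. }
set (r := Rmax r1 T0).
assert (hr : r1 <= r) by apply Rmax_l.
assert (B := PT r (Rmax_r _ _)); apply Rabs_def2 in B.
assert (C1 := Rmin_l 1 (- M r1 / K)); assert (C2 := Rmin_r 1 (- M r1 / K)).
assert (A := Mneg r hr); assert (D := Gpos r hr); unfold G in D.
destruct (sigpos r ltac:(lra)) as [_ [s0 _]].
assert (s1 := sig_le_s r ltac:(lra)).
assert (E := potential_sub_sig r (u r) (Rlt_le _ _ (discpos r ltac:(lra)))).
assert (F := pow2_ge_0 (du r)); unfold M at 1 in A.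
assert (ub : - sig r < u r < sig r) by (split; nra).
assert (q1 : (u r - sig r) ^ 2 <= s - u r) by nra.
assert (q2 : ga * (u r + sig r) ^ 2 - 2 * be / 3 * (2 * u r + sig r) <= K).
{ assert ((u r + sig r) ^ 2 <= 4 * s ^ 2) by nra.
  assert (ga * (u r + sig r) ^ 2 <= ga * (4 * s ^ 2)) by (apply Rmult_le_compat_l;
  lra).
  assert (be * - (2 * u r + sig r) <= be * (2 * s)) by (apply Rmult_le_compat_l; lra).
  assert (0 <= be * s) by (apply Rmult_le_pos; lra); unfold K; lra. }
assert (q3 : (s - u r) * K < - M r1).
{ replace (- M r1) with (- M r1 / K * K) by (field; lra).
  apply Rmult_lt_compat_r; lra. }
assert (q4 := pow2_ge_0 (u r - sig r)).
assert ((u r - sig r) ^ 2 * (ga * (u r + sig r) ^ 2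
  - 2 * be / 3 * (2 * u r + sig r)) <= (u r - sig r) ^ 2 * K)
  by (apply Rmult_le_compat_l; lra).
assert ((u r - sig r) ^ 2 * K <= (s - u r) * K) by (apply Rmult_le_compat_r; lra).
lra.
Qed.

(** * Behaviour at the origin and the sign of [u u'] *)

Context (u_to_0 : forall eps, 0 < eps -> exists d, 0 < d /\
  forall r, 0 < r < d -> Rabs (u r) < eps).

(** Gronwall estimate: [(u^2 + u'^2) e^(- K r)] is nonincreasing. *)
Lemma zero_data_propagates r0 : 0 < r0 -> u r0 = 0 -> du r0 = 0 ->
  forall b, r0 <= b -> u b = 0.
Proof.
intros h0 u0 du0 b hb.
destruct (continuity_ab_maj (fun r => quad al be ga (u r) ^ 2) r0 b hb)
  as [m [Hm _]].
{ intros r hr; assert (hr' : 0 < r) by lra.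
  apply (is_derive_continuity_pt _ _ (2 * quad al be ga (u r) *
    (- be + 2 * ga * u r) * du r)).
  unfold quad; auto_derive; [now solve_ex|].
  rewrite (is_derive_unique (fun x : R => u x) _ _ (Hu r hr')); ring. }
(* Through [|q| <= 1 + q^2], the maximum of [quad^2] bounds [|1 + 6 / r^2 + quad|] on the whole
   interval. *)
set (K := 2 + 6 / r0 ^ 2 + quad al be ga (u m) ^ 2).
set (E := fun r => (u r ^ 2 + du r ^ 2) * exp (- K * r)).
assert (mono : - E r0 <= - E b).
{ apply (derive_nonneg_le (fun r => - E r) (fun r => exp (- K * r) *
   (K * (u r ^ 2 + du r ^ 2) - 2 * (u r * du r)
    * (1 + 6 / r ^ 2 + quad al be ga (u r)) + 4 * du r ^ 2 / r))); [easy| |].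
  - intros r hr; assert (hr' : 0 < r) by lra.
    unfold E; auto_derive; [now solve_ex|].
    rewrite (is_derive_unique (fun x : R => u x) _ _ (Hu r hr')),
      (is_derive_unique (fun x : R => du x) _ _ (Hdu r hr')); field; lra.
  - intros r hr; apply Rmult_le_pos; [apply Rlt_le, exp_pos|].
    assert (A := Hm r hr); simpl in A.
    assert (B : 0 < 6 / r ^ 2 <= 6 / r0 ^ 2).
    { split; [apply Rdiv_lt_0_compat; [lra|apply pow_lt; lra]|].
      apply Rmult_le_compat_l; [lra|].
      apply Rinv_le_contravar; [now apply pow_lt|apply pow_incr; lra]. }
    assert (C : 0 <= 4 * du r ^ 2 / r).
    { apply Rdiv_le_0_compat; [|lra]; assert (P := pow2_ge_0 (du r)); lra. }
    set (k := 1 + 6 / r ^ 2 + quad al be ga (u r)).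
    assert (kK : - K <= k <= K) by (unfold k, K; nra).
    assert (0 <= (u r + du r) ^ 2 * (K - k)) by
      (apply Rmult_le_pos; [apply pow2_ge_0|lra]).
    assert (0 <= (u r - du r) ^ 2 * (K + k)) by
      (apply Rmult_le_pos; [apply pow2_ge_0|lra]).
    nra. }
unfold E in mono; rewrite u0, du0 in mono.
assert (P := exp_pos (- K * b)).
assert (S : u b ^ 2 + du b ^ 2 <= 0).
{ apply Rnot_lt_le; intros N; nra. }
assert (A := pow2_ge_0 (du b)); assert (B := pow2_ge_0 (u b)); nra.
Qed.

Lemma centrifugal_dominates_near_0 : exists d, 0 < d < 1 /\
  forall r, 0 < r < d -> 5 <= 6 + r ^ 2 * quad al be ga (u r).
Proof.
destruct (u_to_0 1 ltac:(lra)) as [d [hd P]].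
assert (h1 : 0 < 1 / (1 + al + be)) by (apply Rdiv_lt_0_compat; lra).
exists (Rmin d (Rmin (1 / 2) (1 / (1 + al + be)))).
assert (A1 := Rmin_l d (Rmin (1 / 2) (1 / (1 + al + be)))).
assert (A2 := Rmin_r d (Rmin (1 / 2) (1 / (1 + al + be)))).
assert (A3 := Rmin_l (1 / 2) (1 / (1 + al + be))).
assert (A4 := Rmin_r (1 / 2) (1 / (1 + al + be))).
split; [split; [|lra]; repeat apply Rmin_glb_lt; lra|].
intros r hr; assert (B := P r ltac:(lra)); apply Rabs_def2 in B.
assert (Q : - (al + be) <= quad al be ga (u r)) by (unfold quad; nra).
assert (C : r * (1 + al + be) < 1).
{ apply (Rmult_lt_reg_r (/ (1 + al + be))); [apply Rinv_0_lt_compat; lra|].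
  replace (r * _ * _) with r by (field; lra); lra. }
assert (r ^ 2 < r) by nra.
assert (0 < r ^ 2) by nra.
assert (r ^ 2 * - (al + be) <= r ^ 2 * quad al be ga (u r))
  by (apply Rmult_le_compat_l; lra).
nra.
Qed.

(** Comes from the divergence form [(r^2 u')' = u (6 + r^2 f(u))]. *)
Lemma is_derive_flux r : 0 < r -> is_derive (fun r => r ^ 2 * (u r * du r)) r
  (r ^ 2 * du r ^ 2 + u r ^ 2 * (6 + r ^ 2 * quad al be ga (u r))).
Proof.
intros hr; auto_derive; [now solve_ex|].
rewrite (is_derive_unique (fun x : R => u x) _ _ (Hu r hr)),
  (is_derive_unique (fun x : R => du x) _ _ (Hdu r hr)); field; lra.
Qed.

Lemma is_derive_sq r : 0 < r -> is_derive (fun r => u r ^ 2) r (2 * (u r * du r)).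
Proof.
intros hr; auto_derive; [now solve_ex|].
rewrite (is_derive_unique (fun x : R => u x) _ _ (Hu r hr)); ring.
Qed.

(** The flux [r^2 u u'] is nondecreasing near 0. A negative value would make [u^2] decreasing from 0
    on, against [u -> 0]. So [u^2] is nondecreasing, and a zero of [u] would force [u = 0] before it
    and, by propagation, everywhere after. Without zeros the flux increases strictly. *)
Lemma flux_pos_near_0 :
  exists d, 0 < d /\ forall r, 0 < r < d -> 0 < u r * du r.
Proof.
destruct centrifugal_dominates_near_0 as [d [hd P]].
exists d; split; [lra|].
set (q := fun r => r ^ 2 * (u r * du r)).
assert (qm : forall x y, 0 < x <= y -> y < d -> q x <= q y).
{ intros x y Hx Hy; eapply (derive_nonneg_le q); [lra| |].
  - intros z Hz; apply is_derive_flux; lra.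
  - intros z Hz; assert (A := P z ltac:(lra)); simpl.
    assert (B := pow2_ge_0 (u z)).
    assert (C := pow2_ge_0 (z * du z)); nra. }
assert (nonneg : forall r, 0 < r < d -> 0 <= u r * du r).
{ intros r1 hr1; apply Rnot_lt_le; intros N.
  assert (neg : forall r, 0 < r <= r1 -> u r * du r < 0).
  { intros r hr; assert (A := qm r r1 hr ltac:(lra)); unfold q in A.
    assert (B : 0 < r ^ 2) by (apply pow_lt; lra).
    assert (C : 0 < r1 ^ 2) by (apply pow_lt; lra).
    apply Rnot_le_lt; intros N'; nra. }
  assert (decr : forall x y, 0 < x < y -> y <= r1 -> u y ^ 2 < u x ^ 2).
  { intros x y Hx Hy; apply Ropp_lt_cancel.
    apply (derive_pos_lt (fun r => - u r ^ 2) (fun r => - (2 * (u r * du r))));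
      [lra| | |].
    - intros z Hz; apply continuity_pt_opp.
      apply (is_derive_continuity_pt _ _ _ (is_derive_sq z ltac:(lra))).
    - intros z Hz; apply (is_derive_opp (fun r => u r ^ 2)), is_derive_sq; lra.
    - intros z Hz; assert (A := neg z ltac:(lra)); lra. }
  assert (A := decr (r1 / 2) r1 ltac:(lra) ltac:(lra)).
  assert (B := pow2_ge_0 (u r1)).
  set (p := u (r1 / 2) ^ 2) in *.
  destruct (u_to_0 (Rmin 1 p)) as [d' [hd' Q]]; [apply Rmin_glb_lt; lra|].
  set (r := Rmin (r1 / 4) (d' / 2)).
  assert (hr : 0 < r < r1 / 2 /\ r < d').
  { unfold r; assert (A1 := Rmin_l (r1 / 4) (d' / 2)).
    assert (A2 := Rmin_r (r1 / 4) (d' / 2)).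
    repeat split; try lra; apply Rmin_glb_lt; lra. }
  assert (C := decr r (r1 / 2) ltac:(lra) ltac:(lra)).
  assert (D := Q r ltac:(lra)); fold p in C.
  assert (D1 := Rmin_l 1 p); assert (D2 := Rmin_r 1 p).
  apply Rabs_def2 in D; nra. }
assert (sqm : forall x y, 0 < x <= y -> y < d -> u x ^ 2 <= u y ^ 2).
{ intros x y Hx Hy; eapply (derive_nonneg_le (fun r => u r ^ 2)); [lra| |].
  - intros z Hz; apply is_derive_sq; lra.
  - intros z Hz; assert (A := nonneg z ltac:(lra)); simpl; lra. }
assert (nz : forall r, 0 < r < d -> u r <> 0).
{ intros r1 hr1 Z.
  assert (z : forall r, 0 < r <= r1 -> u r = 0).
  { intros r hr; assert (A := sqm r r1 hr ltac:(lra)); rewrite Z in A; nra. }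
  assert (Dz : du (r1 / 2) = 0).
  { rewrite <- (is_derive_unique _ _ _ (Hu (r1 / 2) ltac:(lra))).
    rewrite <- (Derive_const 0 (r1 / 2)); apply Derive_ext_loc.
    exists (mkposreal (r1 / 2) ltac:(lra)); intros y By; apply z.
    assert (B : Rabs (y - r1 / 2) < r1 / 2) by exact By.
    apply Rabs_def2 in B; lra. }
  destruct (u_to_s s hs) as [T0 PT].
  assert (A := PT (Rmax (r1 / 2) T0) (Rmax_r _ _)).
  rewrite (zero_data_propagates (r1 / 2) ltac:(lra) (z (r1 / 2) ltac:(lra)) Dz _ (Rmax_l _ _))
    in A.
  apply Rabs_def2 in A; lra. }
intros r hr.
assert (A : q (r / 2) < q r).
{ eapply (derive_pos_lt q); [lra| | |].
  - intros z Hz; apply (is_derive_continuity_pt _ _ _ (is_derive_flux z ltac:(lra))).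
  - intros z Hz; apply is_derive_flux; lra.
  - intros z Hz; simpl; assert (B := P z ltac:(lra)); assert (C := nz z ltac:(lra)).
    assert (D := pow2_ge_0 (z * du z)); assert (0 < u z ^ 2) by (apply pow2_gt_0, C).
    nra. }
assert (B := nonneg (r / 2) ltac:(lra)); unfold q in A.
assert (C : 0 < (r / 2) ^ 2) by (apply pow_lt; lra).
assert (D : 0 < r ^ 2) by (apply pow_lt; lra).
apply Rnot_le_lt; intros N; nra.
Qed.

(** Up to a first zero [T] of the flux [u^2] has not decreased, so [u T <> 0] and [u' = 0] there.
    The nonpositive slope of the flux then gives [6 + T^2 f(u) <= 0], a turning point of the
    excluded kind. *)
Lemma flux_pos r : 0 < r -> 0 < u r * du r.
Proof.
intros hr; apply Rnot_le_lt; intros N.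
destruct flux_pos_near_0 as [d [hd P]].
set (q := fun r => r ^ 2 * (u r * du r)).
assert (qpos : forall x, 0 < x -> 0 < u x * du x -> 0 < q x).
{ intros x hx H; apply Rmult_lt_0_compat; [now apply pow_lt|easy]. }
set (a := Rmin (d / 2) (r / 2)).
assert (ha : 0 < a < r /\ a < d).
{ unfold a; assert (A1 := Rmin_l (d / 2) (r / 2)).
  assert (A2 := Rmin_r (d / 2) (r / 2)).
  repeat split; try lra; apply Rmin_glb_lt; lra. }
destruct (first_zero q a r) as [T [HT [Z Q]]]; try lra.
{ intros x Hx; apply (is_derive_continuity_pt _ _ _ (is_derive_flux x ltac:(lra))). }
{ apply qpos, P; lra. }
{ unfold q; assert (0 < r ^ 2) by now apply pow_lt.
  nra. }
assert (sq : u a ^ 2 <= u T ^ 2).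
{ eapply (derive_nonneg_le (fun r => u r ^ 2)); [lra| |].
  - intros z Hz; apply is_derive_sq; lra.
  - intros z Hz; simpl; destruct (Req_dec z T) as [->|].
    + unfold q in Z; apply Rmult_integral in Z; destruct Z as [Z|Z]; [|lra].
      assert (0 < T ^ 2) by (apply pow_lt; lra); lra.
    + assert (A := Q z ltac:(lra)); unfold q in A.
      assert (0 < z ^ 2) by (apply pow_lt; lra); nra. }
assert (ua : u a <> 0) by (intros E; assert (A := P a ltac:(lra)); rewrite E in A;
lra).
assert (uT : 0 < u T ^ 2) by (assert (A := pow2_gt_0 _ ua); lra).
assert (duT : du T = 0).
{ unfold q in Z; apply Rmult_integral in Z; destruct Z as [Z|Z].
  - assert (0 < T ^ 2) by (apply pow_lt; lra); lra.
  - apply Rmult_integral in Z; destruct Z as [Z|Z]; [|easy].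
    rewrite Z in uT; lra. }
apply (no_turning_point T); [lra|easy|].
assert (A := derive_nonpos_at_first_zero q a T _ ltac:(lra)
  (is_derive_flux T ltac:(lra)) Z Q).
rewrite duT in A.
assert (T2 : 0 < T ^ 2) by (apply pow_lt; lra).
assert (B : 6 + T ^ 2 * quad al be ga (u T) <= 0) by nra.
replace (6 / T ^ 2 + quad al be ga (u T)) with
  ((6 + T ^ 2 * quad al be ga (u T)) / T ^ 2) by (field; lra).
assert (0 < / T ^ 2) by now apply Rinv_0_lt_compat.
unfold Rdiv; nra.
Qed.

(** * Bounds on the solution and passage to the logarithmic system *)

(** [u u' > 0] rules out zeros, and the limit [s > 0] fixes the sign. *)
Lemma solution_pos r : 0 < r -> 0 < u r.
Proof.
intros hr; apply Rnot_le_lt; intros N.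
destruct (Req_dec (u r) 0) as [Z|n].
{ assert (A := flux_pos r hr); rewrite Z in A; lra. }
destruct (u_to_s s hs) as [T0 PT].
set (b := Rmax (r + 1) T0).
assert (hb := Rmax_l (r + 1) T0); fold b in hb.
assert (B := PT b (Rmax_r _ _)); apply Rabs_def2 in B.
destruct (first_zero (fun r => - u r) r b) as [T [HT [Z _]]]; try lra.
{ intros x Hx; apply continuity_pt_opp, u_cont; lra. }
assert (A := flux_pos T ltac:(lra)); replace (u T) with 0 in A by lra; lra.
Qed.

Lemma solution_increasing r : 0 < r -> 0 < du r.
Proof.
intros hr; assert (A := flux_pos r hr); assert (B := solution_pos r hr).
apply Rnot_le_lt; intros N; nra.
Qed.

Lemma solution_lt_s r : 0 < r -> u r < s.
Proof.
intros hr.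
assert (mono : forall x y, 0 < x < y -> u x < u y).
{ intros x y H; apply (derive_pos_lt u du); [lra| | |].
  - intros z Hz; apply u_cont; lra.
  - intros z Hz; apply Hu; lra.
  - intros z Hz; apply solution_increasing; lra. }
apply Rnot_le_lt; intros N.
assert (A := mono r (r + 1) ltac:(lra)).
destruct (u_to_s (u (r + 1) - s) ltac:(lra)) as [T0 PT].
set (b := Rmax (r + 2) T0).
assert (hb := Rmax_l (r + 2) T0); fold b in hb.
assert (B := PT b (Rmax_r _ _)); apply Rabs_def2 in B.
assert (C := mono (r + 1) b ltac:(lra)); lra.
Qed.

Lemma quad_neg v : 0 < v < s -> quad al be ga v < 0.
Proof.
intros hv; unfold quad in *.
(* With [quad s = 0] one has [s quad(v) = - (s - v)(al + ga s v)]. *)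
assert (0 < ga * (s * v * (s - v))).
{ repeat apply Rmult_lt_0_compat; lra. }
assert (0 < al * (s - v)) by (apply Rmult_lt_0_compat; lra).
apply Rnot_le_lt; intros N.
assert (0 <= s * (- al - be * v + ga * v ^ 2)) by (apply Rmult_le_pos; lra).
nra.
Qed.

(** [g] is [r^6 (u / r^2)'], with [g' = r^4 u f(u) < 0]. A nonnegative value would keep [g] above a
    positive constant near 0, where it is at most [r^4 u']. *)
Lemma solution_subquadratic r : 0 < r -> r * du r < 2 * u r.
Proof.
intros hr0; set (g := fun r => r ^ 4 * du r - 2 * r ^ 3 * u r).
assert (Dg : forall r, 0 < r ->
  is_derive g r (r ^ 4 * u r * quad al be ga (u r))).
{ intros x hx; unfold g; auto_derive; [now solve_ex|].
  rewrite (is_derive_unique (fun x : R => u x) _ _ (Hu x hx)),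
    (is_derive_unique (fun x : R => du x) _ _ (Hdu x hx)); field; lra. }
assert (decr : forall x y, 0 < x < y -> g y < g x).
{ intros x y H; apply Ropp_lt_cancel.
  apply (derive_pos_lt (fun r => - g r)
    (fun r => - (r ^ 4 * u r * quad al be ga (u r)))); [lra| | |].
  - intros z Hz; apply continuity_pt_opp.
    apply (is_derive_continuity_pt _ _ _ (Dg z ltac:(lra))).
  - intros z Hz; apply (is_derive_opp g), Dg; lra.
  - intros z Hz; assert (A := solution_pos z ltac:(lra)).
    assert (B := quad_neg (u z) (conj A (solution_lt_s z ltac:(lra)))).
    assert (C : 0 < z ^ 4) by (apply pow_lt; lra).
    assert (0 < z ^ 4 * u z) by now apply Rmult_lt_0_compat.
    nra. }
cut (g r < 0).
{ unfold g; intros A; assert (B : 0 < r ^ 3) by now apply pow_lt.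
  replace (r ^ 4 * du r - 2 * r ^ 3 * u r) with (r ^ 3 * (r * du r - 2 * u r))
    in A by ring.
  apply Rnot_le_lt; intros N; nra. }
apply Rnot_le_lt; intros N.
assert (gp := decr (r / 2) r ltac:(lra)).
set (p := g (r / 2)) in *.
destruct centrifugal_dominates_near_0 as [d [hd P]].
(* Near 0 this is nondecreasing, hence bounded by [C], so that [r^4 u' <= C r^2] tends to 0. *)
set (m := fun r => r ^ 2 * du r).
assert (mm : forall x, 0 < x <= d / 2 -> m x <= m (d / 2)).
{ intros x Hx; apply (derive_nonneg_le m
    (fun r => u r * (6 + r ^ 2 * quad al be ga (u r)))); [lra| |].
  - intros z Hz; assert (hz : 0 < z) by lra; unfold m; auto_derive; [now solve_ex|].
    rewrite (is_derive_unique (fun x : R => du x) _ _ (Hdu z hz)); field; lra.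
  - intros z Hz; apply Rmult_le_pos; [apply Rlt_le, solution_pos; lra|].
    assert (A := P z ltac:(lra)); lra. }
set (C := m (d / 2)) in *.
assert (hC : 0 < C).
{ apply Rmult_lt_0_compat; [apply pow_lt; lra|apply solution_increasing; lra]. }
assert (hp : 0 < p / C) by (apply Rdiv_lt_0_compat; lra).
set (x := Rmin (r / 4) (Rmin (d / 2) (p / C))).
assert (A1 := Rmin_l (r / 4) (Rmin (d / 2) (p / C))).
assert (A2 := Rmin_r (r / 4) (Rmin (d / 2) (p / C))).
assert (A3 := Rmin_l (d / 2) (p / C)).
assert (A4 := Rmin_r (d / 2) (p / C)).
assert (hx : 0 < x) by (unfold x; repeat apply Rmin_glb_lt; lra).
fold x in A1, A2.
assert (A5 := decr x (r / 2) ltac:(lra)); fold p in A5.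
assert (A6 := mm x ltac:(lra)); unfold m in A6.
assert (A7 := solution_pos x hx).
assert (A8 : 0 < x ^ 3 * u x) by (apply Rmult_lt_0_compat; [now apply pow_lt|easy]).
assert (A9 : x ^ 2 * (x ^ 2 * du x) <= x ^ 2 * C).
{ apply Rmult_le_compat_l; [apply pow2_ge_0|easy]. }
assert (A10 : x * C <= p).
{ replace p with (p / C * C) by (field; lra).
  apply Rmult_le_compat_r; lra. }
unfold g in A5; nra.
Qed.

Lemma solution_log_orbit : log_orbit al be ga s (fun t => u (exp t))
  (fun t => exp t * du (exp t) / u (exp t)).
Proof.
assert (pos := fun t => solution_pos (exp t) (exp_pos t)).
refine (conj _ (conj _ (conj _ (conj _ _)))); intros t.
- assert (P := exp_pos t); assert (Q := pos t); auto_derive; [now solve_ex|].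
  rewrite (is_derive_unique (fun x : R => u x) _ _ (Hu (exp t) P)); field; lra.
- assert (P := exp_pos t); assert (Q := pos t); auto_derive.
  + solve_ex; lra.
  + rewrite (is_derive_unique (fun x : R => u x) _ _ (Hu (exp t) P)),
      (is_derive_unique (fun x : R => du x) _ _ (Hdu (exp t) P)).
    replace (exp (2 * t)) with (exp t ^ 2) by
      (simpl; rewrite Rmult_1_r, <- exp_plus; f_equal; ring).
    field; split; lra.
- split; [apply pos|apply solution_lt_s, exp_pos].
- apply quad_neg; split; [apply pos|apply solution_lt_s, exp_pos].
- split.
  { apply Rdiv_lt_0_compat; [|apply pos].
    apply Rmult_lt_0_compat; [|apply solution_increasing]; apply exp_pos. }
  assert (Q := pos t); apply (Rmult_lt_reg_r (u (exp t))); [easy|].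
  replace (_ / _ * _) with (exp t * du (exp t)) by (field; lra).
  apply solution_subquadratic, exp_pos.
Qed.

End Radial.

(** * Return to the radial variable *)

Theorem theorem1p5 (a b c s : R) (u : R -> R)
  (ha : 0 < a ^ 2) (hc : 0 < c ^ 2) (hb : 0 <= b ^ 2)
  (hs : 0 < s) (hFs : bulkF a b c s = 0)
  (hu : is_solution a b c s u) :
  (forall r : R, 0 < r -> 0 < w_of u r < 2) /\
  (forall r : R, 0 < r ->
     Derive_n u 2 r + (- (3 * Derive u r / u r) + 5 / r) * Derive u r >= 0 /\
     2 * a ^ 2 + b ^ 2 / 3 * u r > - (2 / w_of u r) * bulkf a b c (u r) /\
     3 / r ^ 2 * (w_of u r - 2) * (w_of u r + 1) < bulkf a b c (u r) /\
     bulkf a b c (u r) < 1 / r ^ 2 * (w_of u r - 2) * (2 * w_of u r + 3) /\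
     1 / r ^ 2 * (w_of u r - 2) * (2 * w_of u r + 3) < 0).
Proof.
destruct hu as [C2 [ode [lim0 liminf]]].
set (al := a ^ 2) in *; set (be := b ^ 2 / 3); set (ga := 2 * c ^ 2 / 3).
assert (FE : forall t, bulkF a b c t = t * quad al be ga t).
{ intros t; unfold bulkF, quad, al, be, ga; field. }
assert (hbe : 0 <= be) by (unfold be; lra).
assert (hga : 0 < ga) by (unfold ga; lra).
assert (qs : quad al be ga s = 0).
{ rewrite FE in hFs; apply Rmult_integral in hFs; destruct hFs; [lra|easy]. }
assert (Hu : forall r, 0 < r -> is_derive u r (Derive u r)).
{ intros r hr; apply Derive_correct, (C2 r hr). }
assert (Hdu : forall r, 0 < r -> is_derive (Derive u) r
  (u r * (6 / r ^ 2 + quad al be ga (u r)) - 2 / r * Derive u r)).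
{ intros r hr; destruct (C2 r hr) as [_ [D2 _]].
  replace (_ - _) with (Derive_n u 2 r).
  - exact (Derive_correct (Derive u) r D2).
  - assert (A := ode r hr); rewrite FE in A; lra. }
assert (to_s : forall eps, 0 < eps -> exists T, forall r, T <= r ->
  Rabs (u r - s) < eps).
{ intros eps he; apply is_lim_spec in liminf.
  destruct (liminf (mkposreal eps he)) as [T PT].
  exists (T + 1); intros r hr; apply PT; lra. }
assert (to_0 : forall eps, 0 < eps -> exists d, 0 < d /\
  forall r, 0 < r < d -> Rabs (u r) < eps).
{ intros eps he.
  destruct (proj1 (filterlim_locally (F := at_right 0) u 0) lim0
    (mkposreal eps he)) as [d Pd].
  exists d; split; [apply cond_pos|]; intros r hr.
  rewrite <- (Rminus_0_r (u r)); apply (Pd r); [|lra].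
  change (Rabs (r - 0) < d); apply Rabs_def1; lra. }
assert (orbit := solution_log_orbit al be ga s u (Derive u) ha hbe hga hs qs
  Hu Hdu to_s to_0).
set (U := fun t => u (exp t)) in orbit.
set (W := fun t => exp t * Derive u (exp t) / u (exp t)) in orbit.
assert (flim : forall eps, 0 < eps -> exists T, forall t, T <= t ->
  - eps < quad al be ga (U t)).
(* Factoring [quad U - quad s] gives [- quad U <= k (s - U)]. *)
{ intros eps he; set (k := be + 2 * ga * s).
  assert (hk : 0 < k).
  { assert (0 < ga * s) by now apply Rmult_lt_0_compat.
    unfold k; lra. }
  destruct (to_s (eps / k)) as [T PT]; [now apply Rdiv_lt_0_compat|].
  exists T; intros t ht.
  assert (A := PT (exp t)); assert (B := exp_ineq1_le t).
  specialize (A ltac:(lra)); apply Rabs_def2 in A; fold (U t) in A.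
  assert (UB := proj1 (proj2 (proj2 orbit)) t).
  assert (E : quad al be ga (U t) = (U t - s) * (ga * (U t + s) - be)).
  { transitivity (quad al be ga (U t) - quad al be ga s); [lra|].
    unfold quad; ring. }
  assert (F : (s - U t) * k < eps).
  { replace eps with (eps / k * k) by (field; lra).
    apply Rmult_lt_compat_r; lra. }
  assert (G : ga * (U t + s) - be <= k).
  { assert (ga * U t <= ga * s) by (apply Rmult_le_compat_l; lra).
    unfold k; lra. }
  rewrite E; nra. }
assert (main : forall r, 0 < r -> 0 < u r /\ 0 < w_of u r < 2 /\
  r ^ 2 * quad al be ga (u r) < (w_of u r - 2) * (2 * w_of u r + 3) /\
  3 * (w_of u r - 2) * (w_of u r + 1) < r ^ 2 * quad al be ga (u r) /\
  0 < (2 * al + be * u r) * w_of u r + 2 * quad al be ga (u r)).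
{ intros r hr.
  assert (eU : U (ln r) = u r) by (unfold U; now rewrite exp_ln).
  assert (eW : W (ln r) = w_of u r) by (unfold W, w_of; now rewrite exp_ln).
  assert (e2 : exp (2 * ln r) = r ^ 2).
  { replace (2 * ln r) with (ln r + ln r) by ring.
    rewrite exp_plus, exp_ln by easy; ring. }
  assert (A := proj1 (proj2 (proj2 orbit)) (ln r)); rewrite eU in A.
  assert (B := proj2 (proj2 (proj2 (proj2 orbit))) (ln r)); rewrite eW in B.
  assert (E := orbit_eta_neg al be ga s U W ha hbe hga orbit (ln r)).
  assert (Z := orbit_Z_pos al be ga s U W ha hbe hga orbit (ln r)).
  assert (K := orbit_kappa_pos al be ga s U W ha hbe hga orbit (ln r) flim).
  unfold orbit_eta in E; unfold orbit_Z in Z; rewrite eU, eW, ?e2 in *.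
  repeat split; try lra.
  apply Rnot_le_lt; intros N; apply (Rlt_not_le _ _ E).
  apply Rdiv_le_0_compat; lra. }
split; intros r hr; destruct (main r hr) as [u0 [W0 [Y [Z K]]]]; [easy|].
assert (r2 : 0 < r ^ 2) by now apply pow_lt.
assert (i2 : 0 < / r ^ 2) by now apply Rinv_0_lt_compat.
assert (f : bulkf a b c (u r) = quad al be ga (u r)).
{ unfold bulkf; rewrite FE; field; lra. }
rewrite f; repeat split.
- assert (A := ode r hr); rewrite FE in A.
  assert (wE : Derive u r = w_of u r * u r / r).
  { unfold w_of; field; lra. }
  replace (Derive_n u 2 r) with (6 / r ^ 2 * u r + u r * quad al be ga (u r)
    - 2 / r * Derive u r) by lra.
  rewrite wE; set (w := w_of u r) in *.
  replace (_ + _) with (u r * / r ^ 2 * (r ^ 2 * quad al be ga (u r)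
    - 3 * (w - 2) * (w + 1))) by (field; lra).
  apply Rle_ge; repeat apply Rmult_le_pos; lra.
(* Multiplication by [w > 0] turns the inequality into [kappa > 0]. *)
- apply Rlt_gt, (Rmult_lt_reg_r (w_of u r)); [lra|].
  replace (- (2 / w_of u r) * quad al be ga (u r) * w_of u r)
    with (- 2 * quad al be ga (u r)) by (field; lra).
  fold be; lra.
- replace (quad al be ga (u r)) with (/ r ^ 2 * (r ^ 2 * quad al be ga (u r)))
    by (field; lra).
  replace (_ * _ * _) with (/ r ^ 2 * (3 * (w_of u r - 2) * (w_of u r + 1)))
    by (field; lra).
  now apply Rmult_lt_compat_l.
- replace (quad al be ga (u r)) with (/ r ^ 2 * (r ^ 2 * quad al be ga (u r)))
    by (field; lra).
  replace (1 / _ * _ * _) with (/ r ^ 2 * ((w_of u r - 2) * (2 * w_of u r + 3)))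
    by (field; lra).
  now apply Rmult_lt_compat_l.
- replace (1 / _ * _ * _) with (- (/ r ^ 2 * ((2 - w_of u r) * (2 * w_of u r + 3))))
    by (field; lra).
  apply Ropp_lt_gt_0_contravar, Rlt_gt.
  repeat apply Rmult_lt_0_compat; lra.
Qed.
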